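(* Let the Finsler space $F^N$ be conformally isomorphic to the Riemannian space $R^N=\{M,a_{mn}(x)\}$ by means of a fibrewise transformation $y\mapsto \zeta(x,y)$, positively homogeneous of degree $h(x)>0$ in $y$ and sending unit vectors to unit vectors, such that $$g_{mn}(x,y)=\varkappa^2\,\frac{\partial \zeta^i}{\partial y^m}\,\frac{\partial \zeta^j}{\partial y^n}\,a_{ij}(x),\qquad \varkappa=\frac1hK^{1-h},$$ so that the indicatrix at $x$ has constant curvature $\mathcal C=h^2(x)$. Then the angle satisfies $$\alpha_{\text{Finsleroid space}}=\frac1{\sqrt{\mathcal C}}\;\alpha_{\text{Riemannian space}},$$ that is, for nonzero $y_1,y_2\in T_xM$, $$\alpha_{\{x\}}(y_1,y_2)=\frac1{\sqrt{\mathcal C(x)}}\arccos\frac{a_{mn}(x)\,\zeta^m(x,y_1)\,\zeta^n(x,y_2)}{S(x,\zeta(x,y_1))\,S(x,\zeta(x,y_2))}.$$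
   Context: $M$ is an $N$-dimensional differentiable manifold with local coordinates $x^i$, and $y^i$ are the induced components of tangent vectors $y\in T_xM$. The Finsler space $F^N$ is given by a Finsler metric function $K(x,y)>0$ on $TM\setminus 0$ (positively homogeneous of degree 1 in $y$ and strongly convex), with metric tensor $g_{mn}=\frac12\,\partial^2K^2/\partial y^m\partial y^n$. $a_{mn}(x)$ is a Riemannian metric tensor on $M$ and $S(x,\zeta)=\sqrt{a_{mn}(x)\zeta^m\zeta^n}$. The fibrewise transformation is, for each $x\in M$, a diffeomorphism $y\mapsto\zeta(x,y)$ between open regions of $T_xM\setminus\{0\}$ (invariant under multiplication by positive numbers), of class $C^5$ in $y$ and $C^4$ in $x$. Homogeneity means $\zeta^i(x,\gamma y)=\gamma^{h(x)}\zeta^i(x,y)$ for all $\gamma>0$; sending unit vectors to unit vectors means $K(x,y)=1$ if and only if $S(x,\zeta(x,y))=1$. The indicatrix at $x$ is $\{y\in T_xM:K(x,y)=1\}$ with the Riemannian metric induced from the tangent Riemannian space $(T_xM,g_{mn}(x,\cdot))$ ($x$ fixed). The (Finsleroid-space) angle $\alpha_{\{x\}}(y_1,y_2)$ is the length of the geodesic arc of the indicatrix joining the points $y_1/K(x,y_1)$ and $y_2/K(x,y_2)$, these points being taken in a simply connected and geodesically complete region $U_x$ of the indicatrix (any two points of which are joined by such an arc). $\alpha_{\text{Riemannian space}}$ is the ordinary angle, with respect to $a_{mn}(x)$, between the images $\zeta(x,y_1)$ and $\zeta(x,y_2)$.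
   Formalization: The dimension N is taken to be at least 3 (for N=2 the indicatrix is a curve with no curvature, and the angle formula fails on arcs longer than π/h), and the geodesic arc defining the angle is a shortest one within U_x. *)

(* Defs.v *)
From HB Require Import structures.
From mathcomp Require Import all_boot all_order all_algebra.
From mathcomp Require Import all_classical all_reals all_analysis.
Import Order.TTheory GRing.Theory Num.Theory.
Import numFieldNormedType.Exports.

Set Implicit Arguments.
Unset Strict Implicit.
Unset Printing Implicit Defensive.

Local Open Scope classical_set_scope.
Local Open Scope ring_scope.

(* Class C^k on a set A, intended for A open and V finite-dimensional (where
   the continuity of all directional derivatives is that of the differential) *)
Fixpoint Ck (R : realType) (V W : normedModType R) (k : nat) (f : V -> W)
    (A : set V) : Prop :=
  match k with
  | 0 => forall x, A x -> {for x, continuous f}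
  | k'.+1 => (forall x, A x -> differentiable f x) /\
             forall v, Ck k' (fun x => 'D_v f x) A
  end.

Definition smooth (R : realType) (V W : normedModType R) (f : V -> W)
    (A : set V) : Prop := forall k, Ck k f A.

Definition pder (R : realType) (n : nat) (m : 'I_n) (f : 'rV[R]_n -> R)
  (u : 'rV[R]_n) : R := 'D_(delta_mx 0 m) f u.

Definition bform (R : realType) (n : nat) (A : 'M[R]_n) (v w : 'rV[R]_n) : R :=
  \sum_(m < n) \sum_(l < n) A m l * v 0 m * w 0 l.

Definition posdef (R : realType) (n : nat) (A : 'M[R]_n) : Prop :=
  A^T = A /\ forall v, v != 0 -> 0 < bform A v v.

Record manifold (R : realType) (N : nat) := Manifold {
  point :> topologicalType;
  chart : Type;
  chdom : chart -> set point;
  crd : chart -> point -> 'rV[R]_N;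
  crdV : chart -> 'rV[R]_N -> point;
  mfd_hausdorff : hausdorff_space point;
  mfd_countable : @second_countable point;
  mfd_cover : forall x, exists i, chdom i x;
  chdom_open : forall i, open (chdom i);
  chcod_open : forall i, open (crd i @` chdom i);
  crdK : forall i x, chdom i x -> crdV i (crd i x) = x;
  crd_cont : forall i x, chdom i x -> {for x, continuous (crd i)};
  crdV_cont : forall i p,
    (crd i @` chdom i) p -> {for p, continuous (crdV i)};
  crd_smooth : forall i j,
    smooth (crd j \o crdV i) (crd i @` (chdom i `&` chdom j))
}.

(* A vector of T_xM is given by its components y : 'rV_N in a chart i around x;
   [tmap i j x y] are the components of the same vector in the chart j.
   Objects on TM are families indexed by charts, invariant under tmap; their
   values at points x outside the domain of the chart are irrelevant. *)
Definition tmap (R : realType) (N : nat) (M : manifold R N)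
    (i j : chart M) (x : M) (y : 'rV[R]_N) : 'rV[R]_N :=
  'D_y (crd j \o crdV i) (crd i x).

Definition overlap (R : realType) (N : nat) (M : manifold R N)
  (i j : chart M) (x : M) : Prop := chdom i x /\ chdom j x.

Record riemannian (R : realType) (N : nat) (M : manifold R N) := Riemannian {
  rmetric :> chart M -> M -> 'M[R]_N;
  rmetric_posdef : forall i x, chdom i x -> posdef (rmetric i x);
  rmetric_smooth : forall i m n,
    smooth (fun p => rmetric i (crdV i p) m n) (crd i @` chdom i);
  rmetric_inv : forall i j x v w, overlap i j x ->
    bform (rmetric j x) (tmap i j x v) (tmap i j x w) = bform (rmetric i x) v w
}.

(* g_mn = 1/2 d^2 K^2 / dy^m dy^n *)
Definition fmetric (R : realType) (N : nat) (K : 'rV[R]_N -> R)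
    (y : 'rV[R]_N) : 'M[R]_N :=
  \matrix_(m, n) (2^-1 * pder m (pder n (fun z => K z ^+ 2)) y).

(* Only C^2 is required of K on the slit tangent bundle (the least regularity
   for which the metric tensor is defined and continuous). *)
Record finsler (R : realType) (N : nat) (M : manifold R N) := Finsler {
  fun_finsler :> chart M -> M -> 'rV[R]_N -> R;
  finsler_gt0 : forall i x y, chdom i x -> y != 0 -> 0 < fun_finsler i x y;
  finsler_hom : forall i x y (c : R), chdom i x -> y != 0 -> 0 < c ->
    fun_finsler i x (c *: y) = c * fun_finsler i x y;
  finsler_C2 : forall i,
    Ck 2 (fun z : 'rV[R]_N * 'rV[R]_N => fun_finsler i (crdV i z.1) z.2)
         [set z | (crd i @` chdom i) z.1 /\ z.2 != 0];
  finsler_convex : forall i x y, chdom i x -> y != 0 ->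
    posdef (fmetric (fun_finsler i x) y);
  finsler_inv : forall i j x y, overlap i j x -> y != 0 ->
    fun_finsler j x (tmap i j x y) = fun_finsler i x y
}.

(* Fibrewise diffeomorphisms y |-> zeta(x, y) from an open cone tr_dom of
   T_xM \ {0} onto an open cone tr_cod; tr_inv is the inverse. In tr_C4 the
   interior is there because no regularity of the cones in x is assumed. *)
Record fibre_map (R : realType) (N : nat) (M : manifold R N) := FibreMap {
  tr_dom : chart M -> M -> set 'rV[R]_N;
  tr_cod : chart M -> M -> set 'rV[R]_N;
  tr_map :> chart M -> M -> 'rV[R]_N -> 'rV[R]_N;
  tr_inv : chart M -> M -> 'rV[R]_N -> 'rV[R]_N;
  tr_dom_open : forall i x, chdom i x -> open (tr_dom i x);
  tr_cod_open : forall i x, chdom i x -> open (tr_cod i x);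
  tr_dom_neq0 : forall i x y, chdom i x -> tr_dom i x y -> y != 0;
  tr_cod_neq0 : forall i x z, chdom i x -> tr_cod i x z -> z != 0;
  tr_dom_cone : forall i x y (c : R), chdom i x -> 0 < c ->
    tr_dom i x y -> tr_dom i x (c *: y);
  tr_cod_cone : forall i x z (c : R), chdom i x -> 0 < c ->
    tr_cod i x z -> tr_cod i x (c *: z);
  tr_mapP : forall i x y, chdom i x -> tr_dom i x y ->
    tr_cod i x (tr_map i x y) /\ tr_inv i x (tr_map i x y) = y;
  tr_invP : forall i x z, chdom i x -> tr_cod i x z ->
    tr_dom i x (tr_inv i x z) /\ tr_map i x (tr_inv i x z) = z;
  tr_map_C5 : forall i x, chdom i x -> Ck 5 (tr_map i x) (tr_dom i x);
  tr_inv_C5 : forall i x, chdom i x -> Ck 5 (tr_inv i x) (tr_cod i x);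
  tr_map_C4 : forall i y,
    Ck 4 (fun p => tr_map i (crdV i p) y)
      (interior [set p | (crd i @` chdom i) p /\ tr_dom i (crdV i p) y]);
  tr_dom_inv : forall i j x y, overlap i j x ->
    (tr_dom j x (tmap i j x y) <-> tr_dom i x y);
  tr_map_inv : forall i j x y, overlap i j x -> tr_dom i x y ->
    tr_map j x (tmap i j x y) = tmap i j x (tr_map i x y)
}.

Definition riem_norm (R : realType) (n : nat) (A : 'M[R]_n) (v : 'rV[R]_n) : R :=
  Num.sqrt (bform A v v).

Definition riem_angle (R : realType) (n : nat) (A : 'M[R]_n)
    (v w : 'rV[R]_n) : R :=
  acos (bform A v w / (riem_norm A v * riem_norm A w)).

Definition indicatrix (R : realType) (n : nat) (K : 'rV[R]_n -> R)
  : set 'rV[R]_n := [set y | y != 0 /\ K y = 1].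

Definition conformal_factor (R : realType) (n : nat) (K : 'rV[R]_n -> R)
  (h : R) (y : 'rV[R]_n) : R := h^-1 * K y `^ (1 - h).

Definition conformally_isomorphic (R : realType) (N : nat) (M : manifold R N)
    (K : finsler M) (a : riemannian M) (zeta : fibre_map M) (h : M -> R)
    : Prop :=
  forall i x, chdom i x ->
    [/\ 0 < h x,
        (forall y (c : R), tr_dom zeta i x y -> 0 < c ->
           zeta i x (c *: y) = c `^ h x *: zeta i x y),
        (forall y, tr_dom zeta i x y ->
           (K i x y = 1 <-> riem_norm (a i x) (zeta i x y) = 1)) &
        (forall y m n, tr_dom zeta i x y ->
           fmetric (K i x) y m n =
           conformal_factor (K i x) (h x) y ^+ 2 *
           \sum_(k < N) \sum_(l < N)
             pder m (fun z => zeta i x z 0 k) y *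
             pder n (fun z => zeta i x z 0 l) y * a i x k l)].

(* Gamma_{kl,m}, the Christoffel symbols of the first kind of the metric G *)
Definition christoffel (R : realType) (n : nat) (G : 'rV[R]_n -> 'M[R]_n)
    (k l m : 'I_n) (u : 'rV[R]_n) : R :=
  2^-1 * (pder k (fun z => G z l m) u + pder l (fun z => G z k m) u
          - pder m (fun z => G z k l) u).

(* R_{abcd} = d_c Gamma_{db,a} - d_d Gamma_{cb,a}
              + G^{ef} (Gamma_{da,e} Gamma_{cb,f} - Gamma_{ca,e} Gamma_{db,f}),
   with the sign for which the unit sphere has
   R_{abcd} = G_{ac} G_{bd} - G_{ad} G_{bc} *)
Definition curvature (R : realType) (n : nat) (G : 'rV[R]_n -> 'M[R]_n)
    (a b c d : 'I_n) (u : 'rV[R]_n) : R :=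
  pder c (christoffel G d b a) u - pder d (christoffel G c b a) u
  + \sum_(e < n) \sum_(f < n) invmx (G u) e f *
      (christoffel G d a e u * christoffel G c b f u
       - christoffel G c a e u * christoffel G d b f u).

Definition induced_metric (R : realType) (n k : nat) (G : 'rV[R]_n -> 'M[R]_n)
    (p : 'rV[R]_k -> 'rV[R]_n) (u : 'rV[R]_k) : 'M[R]_k :=
  \matrix_(a, b) bform (G (p u)) ('D_(delta_mx 0 a) p u) ('D_(delta_mx 0 b) p u).

(* p parametrizes a piece of the hypersurface S (of codimension 1) *)
Definition local_param (R : realType) (n : nat) (S : set 'rV[R]_n)
    (V : set 'rV[R]_n.-1) (p : 'rV[R]_n.-1 -> 'rV[R]_n) : Prop :=
  [/\ open V, Ck 3 p V, (forall u, V u -> S (p u)) &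
      forall u w, V u -> 'D_w p u = 0 -> w = 0].

Definition constant_curvature (R : realType) (n : nat)
    (G : 'rV[R]_n -> 'M[R]_n) (S : set 'rV[R]_n) (C : R) : Prop :=
  forall V p, local_param S V p -> forall u, V u -> forall a b c d,
    let g := induced_metric G p in
    curvature g a b c d u = C * (g u a c * g u b d - g u a d * g u b c).

Definition path_in (R : realType) (n : nat) (A : set 'rV[R]_n)
    (c : R -> 'rV[R]_n) (u v : 'rV[R]_n) : Prop :=
  [/\ {within `[0, 1], continuous c},
      (forall t, 0 <= t <= 1 -> A (c t)), c 0 = u & c 1 = v].

Definition simply_connected (R : realType) (n : nat) (A : set 'rV[R]_n)
    : Prop :=
  (forall u v, A u -> A v -> exists c, path_in A c u v) /\
  (forall u c, path_in A c u u -> exists H : R * R -> 'rV[R]_n,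
     [/\ {within `[0, 1]%classic `*` `[0, 1]%classic, continuous H},
         (forall s t, 0 <= s <= 1 -> 0 <= t <= 1 -> A (H (s, t))),
         (forall t, 0 <= t <= 1 -> H (0, t) = c t),
         (forall t, 0 <= t <= 1 -> H (1, t) = u) &
         (forall s, 0 <= s <= 1 -> H (s, 0) = u /\ H (s, 1) = u)]).

(* C^k on the closed interval: C^k on some open set containing it *)
Definition curve_in (R : realType) (n k : nat) (A : set 'rV[R]_n)
    (c : R -> 'rV[R]_n) (u v : 'rV[R]_n) : Prop :=
  [/\ (exists O : set R, [/\ open O, `[0, 1]%classic `<=` O & Ck k c O]),
      (forall t, 0 <= t <= 1 -> A (c t)), c 0 = u & c 1 = v].

Definition curve_length (R : realType) (n : nat) (G : 'rV[R]_n -> 'M[R]_n)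
    (c : R -> 'rV[R]_n) : R :=
  \int[lebesgue_measure]_(t in `[0, 1])
    Num.sqrt (bform (G (c t)) (derive1 c t) (derive1 c t)).

(* The Levi-Civita connection of the indicatrix is the tangential part of the
   one of (T_xM, g), so c is a geodesic when its covariant acceleration in
   (T_xM, g) is g-orthogonal to all vectors w tangent to the indicatrix. *)
Definition geodesic (R : realType) (n : nat) (K : 'rV[R]_n -> R)
    (c : R -> 'rV[R]_n) : Prop :=
  forall t, 0 <= t <= 1 -> forall w, 'D_w K (c t) = 0 ->
    \sum_(m < n) w 0 m *
      (\sum_(l < n) fmetric K (c t) m l * derive1 (derive1 c) t 0 l +
       \sum_(k < n) \sum_(l < n)
         christoffel (fmetric K) k l m (c t) *
           derive1 c t 0 k * derive1 c t 0 l) = 0.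

(* Two points of a sphere are ends of geodesics of many lengths; the arc
   defining the angle is one that is shortest among the curves of U. *)
Definition geodesic_arc (R : realType) (n : nat) (K : 'rV[R]_n -> R)
    (U : set 'rV[R]_n) (c : R -> 'rV[R]_n) (u v : 'rV[R]_n) : Prop :=
  [/\ curve_in 2 U c u v, geodesic K c &
      forall d, curve_in 1 U d u v ->
        curve_length (fmetric K) c <= curve_length (fmetric K) d].

Definition indicatrix_region (R : realType) (n : nat) (K : 'rV[R]_n -> R)
    (D U : set 'rV[R]_n) : Prop :=
  [/\ U `<=` D, (exists2 O, open O & U = O `&` indicatrix K),
      simply_connected U &
      forall u v, U u -> U v -> exists c, geodesic_arc K U c u v].

Definition finsleroid_angle (R : realType) (n : nat) (K : 'rV[R]_n -> R)
    (U : set 'rV[R]_n) (y1 y2 : 'rV[R]_n) : R :=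
  xget 0 [set s | exists2 c,
    geodesic_arc K U c ((K y1)^-1 *: y1) ((K y2)^-1 *: y2) &
    s = curve_length (fmetric K) c].

(* Main.v *)
Require Import Defs.
From HB Require Import structures.
From mathcomp Require Import all_boot all_order all_algebra.
From mathcomp Require Import all_classical all_reals all_analysis.
From mathcomp Require Import ring lra.
Import Order.TTheory GRing.Theory Num.Theory.
Import numFieldNormedType.Exports.

Set Implicit Arguments.
Unset Strict Implicit.
Unset Printing Implicit Defensive.

Local Open Scope classical_set_scope.
Local Open Scope ring_scope.

(** Fix a point of the manifold and a chart.  Since the fibre map is
    homogeneous of degree h and sends unit vectors to unit vectors,
    a(zeta(y), zeta(y)) = K(y)^(2h) ([fibre_norm_sqr]), so zeta carries the
    indicatrix K = 1 into the unit sphere of the Euclidean metric a.  There the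
    conformal factor is constant, equal to 1/h, and the induced metric of the
    indicatrix is h^-2 times the pull-back of the metric of the sphere
    ([bform_fmetric_indicatrix]).

    Curvature.  For an immersion q into the unit sphere and a metric
    k <q_a, q_b>, the Christoffel symbols are k <q_ab, q_c>, and the Gauss
    equation gives the sphere curvature divided by k
    ([spherical_curvature]): the quadratic terms are inner products of the
    tangential parts of the q_ab ([gram_projection]), and their normal parts are
    - <q_a, q_b>.  With k = h^-2 the curvature is h^2.

    Angle.  Let c be a geodesic of the indicatrix.  As the derivatives of the
    conformal factor vanish along the indicatrix, the covariant acceleration of
    c is h^-2 times the tangential part of the acceleration of its image
    ([fibre_covariant_acceleration]).  The image is therefore a great circle
    arc t |-> cos(Lt) e1 + sin(Lt) e2, and c has length L / h
    ([geodesic_great_circle]).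

    It remains to see that L = arccos <zeta(c(0)), zeta(c(1))>, that is, that
    L <= pi.  A region of the sphere need not contain the complementary arc, so
    this rests on the minimality of the geodesic arc: an arc longer than pi
    contains a conjugate point in its interior and can be shortened within any
    of its neighbourhoods.  The shortening is explicit.  As n > 2 there is a
    unit vector e3 orthogonal to the plane of the arc, and the arc is lifted to
    the latitude eps sin(pi t) in the direction of e3 ([detour]).  Its length is
    L (1 + eps^2 / 4 ((pi / L)^2 - 1) + o(eps^2)), which is less than L
    ([detour_shorter]); for small eps the lifted arc stays in the open
    image of the region ([detour_near]), and its inverse image is a shorter
    competitor ([shorter_curve]). *)

(** * Differentials and classes C^k *)

Section Differentiation.
Variable R : realType.
Implicit Types U V W : normedModType R.

(** The difference of the two functions vanishes near the point, hence has
    differential 0 there. *)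
Lemma near_eq_differentiable V W (f g : V -> W) x :
  (\near x, f x = g x) -> differentiable f x -> differentiable g x.
Proof.
move=> fg df.
pose e := g - f.
have e0 : \near x, e x = 0.
  by move: fg; apply: filterS => z fgz; rewrite /e !fctE fgz subrr.
have ->: g = f + e by rewrite /e addrC subrK.
apply: differentiableD => //.
have de0 : e \o shift x = cst (e x) + (0 : V -> W) +o_ 0 id.
  apply/eqaddoP => _/posnumP[r]; near=> h.
  have ex0 : e x = 0 by exact: (nbhs_singleton e0).
  rewrite /= !fctE /= ex0 addr0 subr0.
  have -> : e (h + x) = 0.
    near: h.
    by move: e0; rewrite (near_shift 0 x); apply: filterS => h; rewrite /= subr0.
  by rewrite normr0 mulr_ge0//.
have cont0 : continuous (\0 : V -> W) by exact: cst_continuous.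
have dE : 'd e x = (\0 : {linear V -> W}) :> (V -> W) by apply: diff_unique.
by apply/diff_locallyP; rewrite dE; split.
Unshelve. all: by end_near. Qed.

Lemma eq_on_near V (A : set V) (P : V -> Prop) x :
  open A -> A x -> (forall z, A z -> P z) -> \near x, P x.
Proof.
move=> oA Ax AP; have : \forall z \near x, A z by exact: open_nbhs_nbhs.
by apply: filterS.
Qed.

Lemma derive_add V W (f g : V -> W) x v :
  differentiable f x -> differentiable g x ->
  'D_v (fun z => f z + g z) x = 'D_v f x + 'D_v g x.
Proof. by move=> df dg; rewrite -deriveD//; exact: diff_derivable. Qed.

Lemma differentiable_add V W (f g : V -> W) x :
  differentiable f x -> differentiable g x ->
  differentiable (fun z => f z + g z) x.
Proof. exact: differentiableD. Qed.

Lemma differentiable_bigsum V W n (f : 'I_n -> V -> W) x :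
  (forall i, differentiable (f i) x) ->
  differentiable (fun z => \sum_i f i z) x.
Proof.
by move=> df; rewrite (_ : (fun z => _) = \sum_i f i);
  [exact: differentiable_sum | apply/funext => z; rewrite fct_sumE].
Qed.

Lemma derive_bigsum V W n (f : 'I_n -> V -> W) x v :
  (forall i, differentiable (f i) x) ->
  'D_v (fun z => \sum_i f i z) x = \sum_i 'D_v (f i) x.
Proof.
move=> df; rewrite (_ : (fun z => _) = \sum_i f i).
  by rewrite derive_sum// => i; exact: diff_derivable.
by apply/funext => z; rewrite fct_sumE.
Qed.

Lemma diff_scale V W (s : V -> R) (f : V -> W) x :
  differentiable s x -> differentiable f x ->
  differentiable (fun z => s z *: f z) x /\
  forall v, 'D_v (fun z => s z *: f z) x = 'D_v s x *: f x + s x *: 'D_v f x.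
Proof.
move=> ds df.
have sbil : bilinear_for (GRing.Scale.Law.clone _ _ *:%R _)
    (GRing.Scale.Law.clone _ _ *:%R _) (@GRing.scale R W).
  split=> [u'|u] a y z /=; first by rewrite scalerDl scalerA.
  by rewrite scalerDr !scalerA mulrC.
pose bM := bilinear_isBilinear.Build R R W W _ _ (@GRing.scale R W) sbil.
pose B : {bilinear R -> W -> W} := HB.pack (@GRing.scale R W) bM.
have cB : continuous (fun p : R * W => B p.1 p.2) by exact: scale_continuous.
have dB := differentiable_bilin (s x, f x) cB.
have dp := differentiable_pair ds df.
have dc : differentiable (fun z => s z *: f z) x.
  exact: (differentiable_comp dp dB).
split=> // v; rewrite deriveE//.
rewrite (@diff_comp _ _ _ _ (fun z => (s z, f z)) (fun p => B p.1 p.2))//.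
rewrite [LHS]/comp (diff_bilin (s x, f x) cB) diff_pair//=.
by rewrite addrC !deriveE.
Qed.

Lemma derive_comp V W U (f : V -> W) (p : U -> V) x v :
  differentiable p x -> differentiable f (p x) ->
  'D_v (fun z => f (p z)) x = 'D_('D_v p x) f (p x).
Proof.
move=> dp df; rewrite deriveE; last exact: differentiable_comp.
by rewrite (@diff_comp _ _ _ _ p f)//= !deriveE.
Qed.

Lemma derive_lin V W (f : V -> W) x k (v w : V) : differentiable f x ->
  'D_(k *: v + w) f x = k *: 'D_v f x + 'D_w f x.
Proof. by move=> df; rewrite !deriveE// linearP. Qed.

Lemma derive_coords W n (f : 'rV[R]_n -> W) x v : differentiable f x ->
  'D_v f x = \sum_m v 0 m *: 'D_(delta_mx 0 m) f x.
Proof.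
move=> df; rewrite {1}(row_sum_delta v) deriveE// linear_sum.
by apply: eq_bigr => m _; rewrite linearZ /= deriveE.
Qed.

Lemma differentiable_entry V n (f : V -> 'rV[R]_n) x m :
  differentiable f x -> differentiable (fun z => f z 0 m) x.
Proof.
move=> df; exact: (differentiable_comp df (differentiable_coord _ _ _)).
Qed.

Lemma derive_entry V n (f : V -> 'rV[R]_n) x v m :
  differentiable f x -> 'D_v (fun z => f z 0 m) x = ('D_v f x) 0 m.
Proof. by move=> df; rewrite (derive_mx (diff_derivable df)) mxE. Qed.

(** The definition of [Ck] quantifies over functions on the whole space, so
    replacing a function by one that agrees with it on A needs A open: only
    then do the derivatives agree on A too. *)
Lemma Ck_near V W k (f g : V -> W) A : open A ->
  (forall z, A z -> f z = g z) -> Ck k f A -> Ck k g A.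
Proof.
move=> oA; elim: k f g => [|k IH] f g fg /=.
  move=> cf x Ax; have nfg := eq_on_near oA Ax fg.
  change (g @ x --> g x); rewrite -fg//; apply: cvg_trans (cf x Ax).
  exact: near_eq_cvg.
move=> [df Df]; split=> [x Ax|v].
  exact: near_eq_differentiable (eq_on_near oA Ax fg) (df x Ax).
apply: IH (Df v) => z Az.
exact/near_eq_derive/(eq_on_near oA Az fg).
Qed.

Lemma Ck_pred V W k (f : V -> W) A : Ck k.+1 f A -> Ck k f A.
Proof.
elim: k f => [|k IH] f [df Df] /=.
  by move=> x Ax; exact/differentiable_continuous/df.
by split=> // v; exact/IH/Df.
Qed.

Lemma Ck_le V W k l (f : V -> W) A : (k <= l)%N -> Ck l f A -> Ck k f A.
Proof.
move=> /subnK <-; elim: (l - k)%N => [//|m IH].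
by rewrite addSn => /Ck_pred.
Qed.

Lemma Ck_cst V W k (w : W) (A : set V) : Ck k (fun=> w) A.
Proof.
elim: k w => [|k IH] w /=; first by move=> x _; exact: cst_continuous.
split=> [x _|v]; first exact: differentiable_cst.
have -> : (fun x => 'D_v (fun=> w) x) = (fun=> 0) :> (V -> W); last exact: IH.
by apply/funext => x; rewrite derive_cst.
Qed.

Lemma Ck_add V W k (f g : V -> W) A : open A ->
  Ck k f A -> Ck k g A -> Ck k (fun z => f z + g z) A.
Proof.
move=> oA; elim: k f g => [|k IH] f g /=.
  by move=> cf cg x Ax; apply: cvgD; [exact: cf | exact: cg].
move=> [df Df] [dg Dg]; split=> [x Ax|v].
  by apply: differentiable_add; [exact: df | exact: dg].
apply: Ck_near (IH _ _ (Df v) (Dg v)) => // z Az.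
by rewrite derive_add//; [exact: df | exact: dg].
Qed.

Lemma Ck_sum V W k n (f : 'I_n -> V -> W) A : open A ->
  (forall i, Ck k (f i) A) -> Ck k (fun z => \sum_i f i z) A.
Proof.
move=> oA; elim: n f => [|n IH] f Cf.
  by apply: Ck_near (Ck_cst k 0 A) => // z _; rewrite big_ord0.
have := Ck_add oA (Cf ord0) (IH _ (fun i => Cf (lift ord0 i))).
by apply: Ck_near => // z _; rewrite big_ord_recl.
Qed.

Lemma Ck_scale V W k (s : V -> R) (f : V -> W) A : open A ->
  Ck k s A -> Ck k f A -> Ck k (fun z => s z *: f z) A.
Proof.
move=> oA; elim: k s f => [|k IH] s f Cs Cf /=.
  by move=> x Ax; apply: cvgZ; [exact: Cs | exact: Cf].
have [ds Ds] := Cs; have [df Df] := Cf; split=> [x Ax|v].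
  by have [] := diff_scale (ds x Ax) (df x Ax).
have := Ck_add oA (IH _ _ (Ds v) (Ck_pred Cf)) (IH _ _ (Ck_pred Cs) (Df v)).
apply: Ck_near => // z Az.
by have [_ ->] := diff_scale (ds z Az) (df z Az).
Qed.

Lemma Ck_entry V k n (f : V -> 'rV[R]_n) A m : open A ->
  Ck k f A -> Ck k (fun z => f z 0 m) A.
Proof.
move=> oA; elim: k f => [|k IH] f /=.
  move=> cf x Ax.
  exact: (@continuous_comp _ _ _ f (fun z : 'rV[R]_n => z 0 m) x (cf x Ax)
    (@coord_continuous _ _ _ _ _ _)).
move=> [df Df]; split=> [x Ax|v]; first exact/differentiable_entry/df.
by apply: Ck_near (IH _ (Df v)) => // z Az; rewrite derive_entry//; exact: df.
Qed.

(** By the chain rule, D_v (f \o p) is the sum over m of the m-th component of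
    D_v p times (D_m f) \o p.  Expanding in coordinates brings in only
    derivatives of f in fixed directions, to which induction applies. *)
Lemma Ck_comp V W k n (f : 'rV[R]_n -> W) (p : V -> 'rV[R]_n) A B :
  open A -> (forall z, A z -> B (p z)) ->
  Ck k f B -> Ck k p A -> Ck k (fun z => f (p z)) A.
Proof.
move=> oA AB; elim: k f p AB => [|k IH] f p AB Cf Cp /=.
  by move=> x Ax; apply: continuous_comp; [exact: Cp | exact/Cf/AB].
have [df Df] := Cf; have [dp Dp] := Cp; split=> [x Ax|v].
  by apply: differentiable_comp; [exact: dp | exact/df/AB].
have := Ck_sum oA (fun m => Ck_scale oA (Ck_entry m oA (Dp v))
  (IH _ _ AB (Df (delta_mx 0 m)) (Ck_pred Cp))).
apply: Ck_near => // z Az.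
have dfz := df _ (AB _ Az).
by rewrite (derive_comp v (dp z Az) dfz) [RHS]derive_coords.
Qed.

End Differentiation.

(** * Symmetry of second derivatives *)

Section Schwarz.
Variable R : realType.
Implicit Types V : normedModType R.

Lemma differentiable_line V (a v : V) (s : R) :
  differentiable (fun s : R => a + s *: v) s /\
  'D_1 (fun s : R => a + s *: v) s = v.
Proof.
have dl : is_derive s 1 (fun s : R => a + s *: v) v.
  have d2 : is_derive s 1 (fun s : R => s *: v) v.
    have [d E] := diff_scale (ex_diff : differentiable (id : R -> R) s)
      (differentiable_cst v s).
    apply: DeriveDef; first exact/derivable1_diffP.
    by rewrite E derive_cst scaler0 addr0 derive_id scale1r.
  have := is_deriveD (is_derive_cst a s 1) d2.
  by rewrite add0r.
by split; [apply/derivable1_diffP | rewrite derive_val].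
Qed.

Lemma is_derive_line V (f : V -> R) (a v : V) (s : R) :
  differentiable f (a + s *: v) ->
  is_derive s 1 (fun s : R => f (a + s *: v)) ('D_v f (a + s *: v)).
Proof.
move=> df; have [dl vl] := differentiable_line a v s.
apply: DeriveDef; first exact/derivable1_diffP/(differentiable_comp dl df).
rewrite (derive_comp (1 : R) dl df).
exact: (congr1 (fun u => 'D_u f (a + s *: v)) vl).
Qed.

(** The mean value theorem applied twice to the second difference, first in the
    direction v and then in the direction w. *)
Lemma mixed_difference V (f : V -> R) (x v w : V) (h : R) : 0 < h ->
  (forall s t, 0 <= s <= h -> 0 <= t <= h ->
    differentiable f (x + s *: v + t *: w) /\
    differentiable ('D_v f) (x + s *: v + t *: w)) ->
  exists s t, [/\ 0 <= s <= h, 0 <= t <= h &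
    f (x + h *: v + h *: w) - f (x + h *: v) - f (x + h *: w) + f x =
    h ^+ 2 * 'D_w ('D_v f) (x + s *: v + t *: w)].
Proof.
move=> h0 df.
have h00 : (0 : R) <= 0 <= h by rewrite lexx ltW.
have hhh : 0 <= h <= h by rewrite lexx ltW.
pose g s := f (x + h *: w + s *: v) - f (x + s *: v).
have dg s : 0 <= s <= h -> is_derive s 1 g
    ('D_v f (x + h *: w + s *: v) - 'D_v f (x + s *: v)).
  move=> hs; apply: is_deriveB; apply: is_derive_line.
    by have [+ _] := df s h hs hhh; rewrite addrAC.
  by have [+ _] := df s 0 hs h00; rewrite scale0r addr0.
have [||s + gE] := @MVT R g (fun s => 'D_v f (x + h *: w + s *: v) -
    'D_v f (x + s *: v)) 0 h h0.
- by move=> s /itvP hs; apply: dg; rewrite !hs.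
- apply: derivable_within_continuous => s /itvP hs.
  by have [] := dg s; rewrite ?hs.
move=> /itvP hs; have {}hs : 0 <= s <= h by rewrite !hs.
pose k t := 'D_v f (x + s *: v + t *: w).
have dk t : 0 <= t <= h -> is_derive t 1 k ('D_w ('D_v f) (x + s *: v + t *: w)).
  by move=> ht; apply: is_derive_line; have [] := df s t hs ht.
have [||t + kE] := @MVT R k (fun t => 'D_w ('D_v f) (x + s *: v + t *: w)) 0 h h0.
- by move=> t /itvP ht; apply: dk; rewrite !ht.
- apply: derivable_within_continuous => t /itvP ht.
  by have [] := dk t; rewrite ?ht.
move=> /itvP ht; exists s, t; split => //; first by rewrite !ht.
move: gE kE; rewrite /g /k !scale0r !addr0 subr0 (addrAC x).
rewrite (addrAC x (h *: w)) => gE kE; rewrite kE in gE.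
transitivity ('D_w ('D_v f) (x + s *: v + t *: w) * h * h); last by ring.
by rewrite -gE; ring.
Qed.

(** The second difference of f is symmetric in v and w, so by
    [mixed_difference] the two mixed derivatives take a common value at points
    arbitrarily close to x; both are continuous at x. *)
Lemma schwarz_real V (f : V -> R) A (x v w : V) : open A -> A x -> Ck 2 f A ->
  'D_v ('D_w f) x = 'D_w ('D_v f) x.
Proof.
move=> oA Ax [df Df].
apply/eqP; rewrite -subr_eq0 -normr_le0; apply/ler_addgt0Pl => e e0; rewrite addr0.
have e20 : 0 < e / 2 by rewrite divr_gt0.
have cont u z : {for x, continuous ('D_u ('D_z f))}.
  by have [_ /(_ u)] := Df z; apply.
have /(cvgrPdist_lt _ _).1 /(_ _ e20) n1 := cont v w.
have /(cvgrPdist_lt _ _).1 /(_ _ e20) n2 := cont w v.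
have n3 : \forall z \near x, A z by exact: open_nbhs_nbhs.
have n123 := filterI n3 (filterI n1 n2).
have [r /= r0 rP] := (nbhs_ballP _ _).1 (n123 _ _).
pose h := r / (`|v| + `|w| + 1).
have D0 : 0 < `|v| + `|w| + 1 by rewrite ltr_wpDl// addr_ge0.
have h0 : 0 < h by rewrite divr_gt0.
have near s t : 0 <= s <= h -> 0 <= t <= h -> ball x r (x + s *: v + t *: w).
  move=> /andP[s0 sh] /andP[t0 th].
  rewrite -ball_normE /ball_/= -addrA opprD addNKr normrN.
  apply: (@le_lt_trans _ _ (h * (`|v| + `|w|))); last first.
    by rewrite /h mulrAC ltr_pdivrMr// ltr_pM2l// ltrDl.
  apply: (le_trans (ler_normD _ _)); rewrite mulrDr !normrZ !ger0_norm//.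
  by apply: lerD; apply: ler_wpM2r.
have [|s1 [t1 [hs1 ht1 E1]]] := @mixed_difference V f x v w h h0.
  move=> s t hs ht; have [As _] := rP _ (near s t hs ht).
  by split; [exact: df | have [+ _] := Df v; exact].
have [|s2 [t2 [hs2 ht2 E2]]] := @mixed_difference V f x w v h h0.
  move=> s t hs ht; have := rP _ (near t s ht hs).
  rewrite addrAC => -[As _].
  by split; [exact: df | have [+ _] := Df w; exact].
have [_ [_ B1]] := rP _ (near _ _ hs1 ht1).
have := rP _ (near _ _ ht2 hs2); rewrite addrAC => -[_ [B2 _]].
have E : 'D_v ('D_w f) (x + s2 *: w + t2 *: v) =
         'D_w ('D_v f) (x + s1 *: v + t1 *: w).
  apply: (mulfI (_ : h ^+ 2 != 0)); first by rewrite expf_neq0// gt_eqF.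
  have Ex : x + h *: v + h *: w = x + h *: w + h *: v by exact: addrAC.
  rewrite Ex in E1; apply: etrans E1; apply: etrans (esym E2) _.
  by congr (_ + _); exact: addrAC.
rewrite -(subrKA ('D_v ('D_w f) (x + s2 *: w + t2 *: v))) (splitr e).
apply: (le_trans (ler_normD _ _)); apply: lerD; first exact: ltW B2.
by rewrite E distrC; exact: ltW B1.
Qed.

Lemma schwarz V n (f : V -> 'rV[R]_n) A (x v w : V) : open A -> A x ->
  Ck 2 f A -> 'D_v ('D_w f) x = 'D_w ('D_v f) x.
Proof.
move=> oA Ax Cf; apply/rowP => m; have [df Df] := Cf.
have dD u : differentiable ('D_u f) x by have [+ _] := Df u; exact.
apply: etrans (esym (derive_entry v m (dD w))) _.
apply: etrans _ (derive_entry w m (dD v)).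
have entry u : \near x, 'D_u (fun z => f z 0 m) x = 'D_u f x 0 m.
  by apply: eq_on_near oA Ax _ => z /df dz; rewrite derive_entry.
apply: etrans (esym (near_eq_derive v (entry w))) _.
apply: etrans _ (near_eq_derive w (entry v)).
exact: schwarz_real oA Ax (Ck_entry m oA Cf).
Qed.

End Schwarz.

(** * Bilinear forms and tangential projections *)

Section BilinearForm.
Variables (R : realType) (n : nat).
Implicit Types (A : 'M[R]_n) (u v w : 'rV[R]_n).

Lemma bformE A v w : bform A v w = (v *m A *m w^T) 0 0.
Proof.
rewrite /bform exchange_big mxE /=; apply: eq_bigr => l _.
by rewrite !mxE mulr_suml; apply: eq_bigr => m _; rewrite (mulrC (A m l)).
Qed.

Lemma bformDl A u v w : bform A (u + v) w = bform A u w + bform A v w.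
Proof. by rewrite !bformE !mulmxDl mxE. Qed.

Lemma bformDr A u v w : bform A u (v + w) = bform A u v + bform A u w.
Proof. by rewrite !bformE linearD mulmxDr mxE. Qed.

Lemma bformZl A (k : R) v w : bform A (k *: v) w = k * bform A v w.
Proof. by rewrite !bformE -!scalemxAl mxE. Qed.

Lemma bformZr A (k : R) v w : bform A v (k *: w) = k * bform A v w.
Proof. by rewrite !bformE linearZ -scalemxAr mxE. Qed.

Lemma bformNl A v w : bform A (- v) w = - bform A v w.
Proof. by rewrite -scaleN1r bformZl mulN1r. Qed.

Lemma bform0l A w : bform A 0 w = 0.
Proof. by rewrite -(scale0r 0) bformZl mul0r. Qed.

Lemma bform0r A w : bform A w 0 = 0.
Proof. by rewrite -(scale0r 0) bformZr mul0r. Qed.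

Lemma bform_suml I (r : seq I) (P : pred I) A (F : I -> 'rV[R]_n) w :
  bform A (\sum_(i <- r | P i) F i) w = \sum_(i <- r | P i) bform A (F i) w.
Proof.
by apply: (big_morph (fun v => bform A v w) _ (bform0l A w)) => u v;
  rewrite bformDl.
Qed.

Lemma bform_sumr I (r : seq I) (P : pred I) A (F : I -> 'rV[R]_n) w :
  bform A w (\sum_(i <- r | P i) F i) = \sum_(i <- r | P i) bform A w (F i).
Proof.
by apply: (big_morph (fun v => bform A w v) _ (bform0r A w)) => u v;
  rewrite bformDr.
Qed.

Lemma bformC A v w : A^T = A -> bform A v w = bform A w v.
Proof.
move=> sA; rewrite !bformE; transitivity ((v *m A *m w^T)^T 0 0).
  by rewrite [RHS]mxE.
by rewrite !trmx_mul trmxK sA mulmxA.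
Qed.

Lemma bform_ge0 A v : posdef A -> 0 <= bform A v v.
Proof.
move=> [_ pA]; have [->|v0] := eqVneq v 0; first by rewrite bform0l.
exact/ltW/pA.
Qed.

Lemma bform_eq0 A v : posdef A -> bform A v v = 0 -> v = 0.
Proof.
move=> [_ pA] vv; apply/eqP/negPn/negP => /pA.
by rewrite vv ltxx.
Qed.

Lemma diff_bform (V : normedModType R) A (f g : V -> 'rV[R]_n) x :
  differentiable f x -> differentiable g x ->
  differentiable (fun z => bform A (f z) (g z)) x /\
  forall d, 'D_d (fun z => bform A (f z) (g z)) x =
    bform A ('D_d f x) (g x) + bform A (f x) ('D_d g x).
Proof.
move=> df dg.
pose h m l z : R := A m l *: (f z 0 m *: (g z 0 l : R)).
have dh m l : differentiable (h m l) x /\ forall d, 'D_d (h m l) x =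
    A m l * (('D_d f x) 0 m * g x 0 l + f x 0 m * ('D_d g x) 0 l).
  have [dfg Dfg] := diff_scale (differentiable_entry m df)
                               (differentiable_entry l dg).
  have [dA DA] := diff_scale (differentiable_cst (A m l : R) x) dfg.
  split=> // d; rewrite DA Dfg derive_cst scale0r add0r.
  by rewrite (derive_entry d m df) (derive_entry d l dg).
have dhm m : differentiable (fun z => \sum_l h m l z) x.
  by apply: differentiable_bigsum => l; have [] := dh m l.
have bE : (fun z => bform A (f z) (g z)) = (fun z => \sum_m \sum_l h m l z).
  apply/funext => z; apply: eq_bigr => m _; apply: eq_bigr => l _.
  by rewrite -mulrA.
rewrite bE; split; first exact: differentiable_bigsum.
move=> d; rewrite derive_bigsum//.
rewrite /bform -big_split; apply: eq_bigr => m _.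
rewrite derive_bigsum; last by move=> l; have [] := dh m l.
rewrite -big_split; apply: eq_bigr => l _.
have [_ ->] := dh m l; rewrite mulrDr !mulrA.
by congr (_ + _).
Qed.

End BilinearForm.

Section TangentProjection.
Variables (R : realType) (n : nat) (A : 'M[R]_n).
Hypothesis pA : posdef A.

(** The T_e are n - 1 independent vectors in the hyperplane orthogonal to the
    unit vector q, so they span it; X minus its component along q lies there. *)
Lemma tangent_coords (q : 'rV[R]_n) (T : 'I_n.-1 -> 'rV[R]_n) :
  bform A q q = 1 -> (forall e, bform A (T e) q = 0) ->
  (forall x : 'rV[R]_n.-1, \sum_e x 0 e *: T e = 0 -> x = 0) ->
  forall X, exists x : 'rV[R]_n.-1,
    X = bform A X q *: q + \sum_e x 0 e *: T e.
Proof.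
move=> qq Tq Tfree X.
pose B : 'M[R]_(n.-1, n) := \matrix_e T e.
have BE (x : 'rV[R]_n.-1) : x *m B = \sum_e x 0 e *: T e.
  by rewrite mulmx_sum_row; apply: eq_bigr => e _; rewrite rowK.
have n0 : (0 < n)%N.
  rewrite lt0n; apply/eqP => n0; move/eqP: qq.
  rewrite /bform big1 1?eq_sym ?oner_eq0// => m _.
  by have := ltn_ord m; rewrite {2}n0.
have rB : \rank B = n.-1.
  apply/eqP; rewrite -[_ == _]/(row_free B); apply: inj_row_free => x.
  by rewrite BE; exact: Tfree.
pose c : 'cV[R]_n := A *m q^T.
have cE v : v *m c = (bform A v q)%:M.
  by rewrite mulmxA [LHS]mx11_scalar bformE.
have rc : \rank c = 1%N.
  apply/eqP; rewrite eqn_leq rank_leq_col lt0n mxrank_eq0.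
  apply/negP => /eqP c0; have := cE q; rewrite c0 mulmx0 qq => /matrixP/(_ 0 0).
  by rewrite !mxE /= => /eqP; rewrite eq_sym oner_eq0.
have Bker : (B <= kermx c)%MS.
  apply/sub_kermxP/row_matrixP => e.
  by rewrite row_mul rowK row0 cE Tq; apply/matrixP => i j; rewrite !mxE mul0rn.
have kerB : (kermx c <= B)%MS.
  by rewrite -(mxrank_leqif_sup Bker) mxrank_ker rB rc subn1.
have : (X - bform A X q *: q <= B)%MS.
  apply: submx_trans kerB; apply/sub_kermxP.
  by rewrite cE bformDl bformNl bformZl qq mulr1 subrr; apply/matrixP => i j;
    rewrite !mxE mul0rn.
move=> /submxP[x xB]; exists x.
by rewrite -BE -xB addrC subrK.
Qed.

(** The double sum is the inner product of the tangential parts of X and Y,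
    written with the inverse of the Gram matrix g of the tangent vectors T_e. *)
Lemma gram_projection (q : 'rV[R]_n) (T : 'I_n.-1 -> 'rV[R]_n) (k : R)
    (g : 'M[R]_n.-1) : k != 0 ->
  (forall e f, g e f = k * bform A (T e) (T f)) ->
  bform A q q = 1 -> (forall e, bform A (T e) q = 0) ->
  (forall x : 'rV[R]_n.-1, \sum_e x 0 e *: T e = 0 -> x = 0) ->
  forall X Y, \sum_e \sum_f invmx g e f *
      ((k * bform A X (T e)) * (k * bform A Y (T f))) =
    k * (bform A X Y - bform A X q * bform A Y q).
Proof.
move=> k0 gE qq Tq Tfree X Y; have sA := pA.1.
have gx (x : 'rV[R]_n.-1) f :
    (x *m g) 0 f = k * bform A (\sum_e x 0 e *: T e) (T f).
  rewrite mxE bform_suml mulr_sumr; apply: eq_bigr => e _.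
  by rewrite gE bformZl mulrCA.
have gu : g \in unitmx.
  rewrite -row_free_unit; apply: inj_row_free => x xg; apply: Tfree.
  apply: (bform_eq0 pA); apply: (mulfI k0); rewrite mulr0 bform_sumr mulr_sumr.
  apply: big1 => f _; rewrite bformZr mulrCA.
  by rewrite -gx xg mxE mulr0.
have [x xE] := tangent_coords qq Tq Tfree X.
have XT e : k * bform A X (T e) = (x *m g) 0 e.
  rewrite gx; congr (_ * _); rewrite [in LHS]xE bformDl bformZl (bformC q _ sA).
  by rewrite Tq mulr0 add0r.
transitivity (\sum_f x 0 f * (k * bform A Y (T f))).
  rewrite exchange_big /=; apply: eq_bigr => f _.
  rewrite -[in RHS](mulmxK gu x) mxE mulr_suml.
  by apply: eq_bigr => e _; rewrite XT mulrCA mulrA.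
transitivity (k * bform A (\sum_e x 0 e *: T e) Y).
  rewrite bform_suml mulr_sumr; apply: eq_bigr => e _.
  by rewrite bformZl mulrCA (bformC (T e) _ sA).
have -> : \sum_e x 0 e *: T e = X - bform A X q *: q.
  by rewrite [X in X - _]xE addrC addKr.
by rewrite bformDl bformNl bformZl (bformC q Y sA).
Qed.

End TangentProjection.

(* Directional derivatives are compared syntactically from here on, never by
   unfolding the limits that define them. *)
Local Opaque derive.

(** * The Gauss equation for the unit sphere *)

Section Gauss.
Variable R : realType.

Lemma diff_cmul (V : normedModType R) (k : R) (f : V -> R) x :
  differentiable f x -> differentiable (fun z => k * f z) x /\
  forall v, 'D_v (fun z => k * f z) x = k * 'D_v f x.
Proof.
move=> df; have [dk Dk] := diff_scale (differentiable_cst (k : R) x) df.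
by split=> // v; rewrite Dk derive_cst scale0r add0r.
Qed.

(* Q, QQ and QQQ name the partial derivatives of q of order 1, 2 and 3; as
   variables they are opaque to unification. *)
Variables (n : nat) (A : 'M[R]_n) (k : R) (V : set 'rV[R]_n.-1)
  (q : 'rV[R]_n.-1 -> 'rV[R]_n) (g : 'rV[R]_n.-1 -> 'M[R]_n.-1)
  (Q : 'I_n.-1 -> 'rV[R]_n.-1 -> 'rV[R]_n)
  (QQ : 'I_n.-1 -> 'I_n.-1 -> 'rV[R]_n.-1 -> 'rV[R]_n)
  (QQQ : 'I_n.-1 -> 'I_n.-1 -> 'I_n.-1 -> 'rV[R]_n.-1 -> 'rV[R]_n).
Hypotheses (pA : posdef A) (k0 : k != 0) (oV : open V) (Cq : Ck 3 q V)
  (qq : forall u, V u -> bform A (q u) (q u) = 1)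
  (q_immersion : forall u w, V u -> 'D_w q u = 0 -> w = 0)
  (QE : forall a u, 'D_(delta_mx 0 a) q u = Q a u)
  (QQE : forall a b u, 'D_(delta_mx 0 a) (Q b) u = QQ a b u)
  (QQQE : forall a b c u, 'D_(delta_mx 0 a) (QQ b c) u = QQQ a b c u)
  (gE : forall u a b, V u -> g u a b = k * bform A (Q a u) (Q b u)).

Let sA : A^T = A := pA.1.

Let dq u : V u -> differentiable q u.
Proof. by have [+ _] := Cq; exact. Qed.

Let CQ a : Ck 2 (Q a) V.
Proof.
have [_ Dq] := Cq.
by apply: (@Ck_near _ _ _ 2 _ _ _ oV _ (Dq (delta_mx 0 a))).
Qed.

Let CQQ a b : Ck 1 (QQ a b) V.
Proof.
have [_ DQ] := CQ b.
by apply: (@Ck_near _ _ _ 1 _ _ _ oV _ (DQ (delta_mx 0 a))).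
Qed.

Let dQ u a : V u -> differentiable (Q a) u.
Proof. by have [+ _] := CQ a; exact. Qed.

Let dQQ u a b : V u -> differentiable (QQ a b) u.
Proof. by have [+ _] := CQQ a b; exact. Qed.

Let QQC u a b : V u -> QQ a b u = QQ b a u.
Proof.
move=> Vu.
have F c : 'D_(delta_mx 0 c) q = Q c := funext (QE c).
have E c d : 'D_(delta_mx 0 c) ('D_(delta_mx 0 d) q) u = QQ c d u.
  by rewrite F QQE.
by rewrite -!E; exact: (schwarz _ _ oV Vu (Ck_pred Cq)).
Qed.

Let QQQC u a b c : V u -> QQQ a b c u = QQQ b a c u.
Proof.
move=> Vu.
have F d : 'D_(delta_mx 0 d) (Q c) = QQ d c := funext (QQE d c).
have E d e : 'D_(delta_mx 0 d) ('D_(delta_mx 0 e) (Q c)) u = QQQ d e c u.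
  by rewrite F QQQE.
by rewrite -!E; exact: (schwarz _ _ oV Vu (CQ c)).
Qed.

Let pder_metric u a b c : V u -> pder a (fun z => g z b c) u =
  k * (bform A (QQ a b u) (Q c u) + bform A (Q b u) (QQ a c u)).
Proof.
move=> Vu; have [db Db] := diff_bform A (dQ b Vu) (dQ c Vu).
have [_ Dk] := diff_cmul k db; rewrite -!QQE.
apply: etrans _ (congr1 ( *%R k) (Db _)).
apply: etrans _ (Dk _); apply: near_eq_derive.
by apply: eq_on_near oV Vu _ => z /gE.
Qed.

(** In the three terms of the Christoffel symbol, the products that do not
    involve Q c cancel by the symmetry of second derivatives. *)
Let christoffelE u a b c : V u ->
  christoffel g a b c u = k * bform A (QQ a b u) (Q c u).
Proof.
move=> Vu; rewrite /christoffel !pder_metric//.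
rewrite (QQC b a Vu) (QQC c a Vu) (QQC c b Vu).
rewrite (bformC (QQ a c u) _ sA) (bformC (Q a u) _ sA).
move: (bform _ _ _) (bform _ _ _) (bform _ _ _) => x y z.
by field.
Qed.

Let pder_christoffel u a b c d : V u ->
  pder d (christoffel g a b c) u =
  k * (bform A (QQQ d a b u) (Q c u)
       + bform A (QQ a b u) (QQ d c u)).
Proof.
move=> Vu; have [db Db] := diff_bform A (dQQ a b Vu) (dQ c Vu).
have [_ Dk] := diff_cmul k db; rewrite -QQQE -(QQE d c).
apply: etrans _ (congr1 ( *%R k) (Db _)).
apply: etrans _ (Dk _); apply: near_eq_derive.
by apply: eq_on_near oV Vu _ => z Vz; rewrite christoffelE.
Qed.

Let tangent_normal u a : V u -> bform A (Q a u) (q u) = 0.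
Proof.
move=> Vu; have [_ Dqq] := diff_bform A (dq Vu) (dq Vu).
have := Dqq (delta_mx 0 a); rewrite QE (bformC (q u) _ sA) => E.
have : 'D_(delta_mx 0 a) (fun z => bform A (q z) (q z)) u = 0.
  apply: etrans _ (derive_cst (1 : R) u (delta_mx 0 a)).
  apply: near_eq_derive.
  by apply: eq_on_near oV Vu _ => z /qq.
by rewrite E => /eqP; rewrite -mulr2n mulrn_eq0 => /eqP.
Qed.

(** Differentiate <Q b, q> = 0: the second fundamental form of the unit sphere
    is minus its metric. *)
Let second_form u a b : V u ->
  bform A (QQ a b u) (q u) = - bform A (Q a u) (Q b u).
Proof.
move=> Vu; have [_ /(_ (delta_mx 0 a))] := diff_bform A (dQ b Vu) (dq Vu).
rewrite QE QQE => E.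
apply/eqP; rewrite -addr_eq0 (bformC (Q a u) _ sA); apply/eqP.
apply: etrans (esym E) _.
apply: etrans _ (derive_cst (0 : R) u (delta_mx 0 a)); apply: near_eq_derive.
by apply: eq_on_near oV Vu _ => z /tangent_normal.
Qed.

(** The Gauss equation.  The third derivatives cancel by symmetry.  The
    quadratic terms are k times the inner products of the tangential parts of
    second derivatives; their full inner products cancel against those left by
    the derivatives of the Christoffel symbols, so that only products of normal
    parts remain. *)
Lemma spherical_curvature u a b c d : V u ->
  curvature g a b c d u = k^-1 * (g u a c * g u b d - g u a d * g u b c).
Proof.
move=> Vu; rewrite /curvature !pder_christoffel// (QQQC d c b Vu).
have free (x : 'rV[R]_n.-1) : \sum_e x 0 e *: Q e u = 0 -> x = 0.
  move=> x0; apply: (q_immersion Vu); rewrite (derive_coords _ (dq Vu)).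
  by rewrite -[RHS]x0; apply: eq_bigr => e _; rewrite QE.
have proj := gram_projection pA k0 (fun e f => gE e f Vu) (qq Vu)
  (fun e => tangent_normal e Vu) free.
rewrite (_ : \sum_e _ = k * (bform A (QQ d a u) (QQ c b u) -
    bform A (Q d u) (Q a u) * bform A (Q c u) (Q b u)) -
  k * (bform A (QQ c a u) (QQ d b u) -
    bform A (Q c u) (Q a u) * bform A (Q d u) (Q b u))); last first.
  have E x y z w : bform A (Q x u) (Q y u) * bform A (Q z u) (Q w u) =
      bform A (QQ x y u) (q u) * bform A (QQ z w u) (q u).
    by rewrite !second_form// mulrNN.
  rewrite !E -!proj -sumrB; apply: eq_bigr => e _.
  by rewrite -sumrB; apply: eq_bigr => f _; rewrite !christoffelE// mulrBr.
rewrite !gE// (bformC (QQ d b u) _ sA) (bformC (QQ c b u) _ sA).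
rewrite (bformC (Q d u) (Q a u) sA) (bformC (Q c u) (Q b u) sA).
rewrite (bformC (Q c u) (Q a u) sA) (bformC (Q d u) (Q b u) sA).
move: (bform A (QQ c a u) _) (bform A (QQ d a u) _) => X1 X2.
move: (bform A (QQQ _ _ _ _) _) => X3.
move: (bform A (Q a u) (Q c u)) (bform A (Q a u) (Q d u)) => X4 X5.
move: (bform A (Q b u) (Q c u)) (bform A (Q b u) (Q d u)) => X6 X7.
by field.
Qed.

End Gauss.

(** * Christoffel symbols contracted with vectors *)

Section Christoffel.
Variables (R : realType) (n : nat).

Lemma derive_bform_matrix (V : normedModType R) (G : V -> 'M[R]_n)
    (v w : 'rV[R]_n) u d :
  (forall l m, differentiable (fun z => G z l m) u) ->
  differentiable (fun z => bform (G z) v w) u /\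
  'D_d (fun z => bform (G z) v w) u =
    \sum_l \sum_m 'D_d (fun z => G z l m) u * v 0 l * w 0 m.
Proof.
move=> dG.
pose k l m := v 0 l * w 0 m.
have dk l m := diff_cmul (k l m) (dG l m).
have dkl l : differentiable (fun z => \sum_m k l m * G z l m) u.
  by apply: differentiable_bigsum => m; have [] := dk l m.
have -> : (fun z => bform (G z) v w) =
    (fun z => \sum_l \sum_m k l m * G z l m).
  by apply/funext => z; apply: eq_bigr => l _; apply: eq_bigr => m _;
    rewrite mulrC mulrA mulrC mulrCA mulrA (mulrC (w 0 m)).
split; first exact: differentiable_bigsum.
rewrite derive_bigsum//; apply: eq_bigr => l _.
rewrite derive_bigsum; last by move=> m; have [] := dk l m.
apply: eq_bigr => m _; have [_ ->] := dk l m.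
by rewrite mulrC mulrA.
Qed.

(** For constant v and w, contracting the definition of the Christoffel symbols
    turns its three terms into derivatives of the functions G(v, w) and G(v, v).
    This avoids coordinates in the computations with conformal metrics. *)
Lemma christoffel_contraction (G : 'rV[R]_n -> 'M[R]_n)
    (v w u : 'rV[R]_n) :
  (forall l m, differentiable (fun z => G z l m) u) ->
  \sum_m w 0 m * (\sum_k \sum_l christoffel G k l m u * v 0 k * v 0 l) =
  'D_v (fun z => bform (G z) v w) u - 2^-1 * 'D_w (fun z => bform (G z) v v) u.
Proof.
move=> dG.
have DE d x y : 'D_d (fun z => bform (G z) x y) u = \sum_k \sum_l \sum_m
    pder k (fun z => G z l m) u * d 0 k * x 0 l * y 0 m.
  have [dB _] := derive_bform_matrix x y d dG.
  rewrite derive_coords//; apply: eq_bigr => k _.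
  have [_ ->] := derive_bform_matrix x y (delta_mx 0 k) dG.
  rewrite /GRing.scale /= mulr_sumr; apply: eq_bigr => l _.
  rewrite mulr_sumr; apply: eq_bigr => m _.
  by rewrite /pder !mulrA (mulrC (d 0 k)).
pose S1 := \sum_m \sum_k \sum_l
  pder k (fun z => G z l m) u * v 0 k * v 0 l * w 0 m.
pose S2 := \sum_m \sum_k \sum_l
  pder l (fun z => G z k m) u * v 0 l * v 0 k * w 0 m.
pose S3 := \sum_m \sum_k \sum_l
  pder m (fun z => G z k l) u * w 0 m * v 0 k * v 0 l.
transitivity (2^-1 * (S1 + S2 - S3)).
  rewrite -big_split -sumrB mulr_sumr; apply: eq_bigr => m _ /=.
  rewrite -big_split -sumrB !mulr_sumr; apply: eq_bigr => k _ /=.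
  rewrite -big_split -sumrB !mulr_sumr; apply: eq_bigr => l _ /=.
  rewrite /christoffel.
  move: (pder _ _ _) (pder _ _ _) (pder _ _ _) => x y z.
  by ring.
have S1E : S1 = 'D_v (fun z => bform (G z) v w) u.
  rewrite DE /S1 exchange_big /=; apply: eq_bigr => k _.
  by rewrite exchange_big.
have S2E : S2 = S1.
  by apply: eq_bigr => m _; rewrite exchange_big.
have S3E : S3 = 'D_w (fun z => bform (G z) v v) u by rewrite DE.
rewrite S2E S3E S1E.
move: ('D_v _ _) ('D_w _ _) => x y.
by field.
Qed.

(** A directional derivative of f along a moving point p, in a moving direction
    v: with p a curve and v its velocity this is the acceleration of f \o p. *)
Lemma derive_along (V W : normedModType R) (f : 'rV[R]_n -> W)
    (p v : V -> 'rV[R]_n) x d B : open B -> Ck 2 f B -> B (p x) ->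
  differentiable p x -> differentiable v x ->
  differentiable (fun t => 'D_(v t) f (p t)) x /\
  'D_d (fun t => 'D_(v t) f (p t)) x =
    'D_('D_d v x) f (p x) + 'D_('D_d p x) ('D_(v x) f) (p x).
Proof.
move=> oB [df Df] Bp dp dv.
have dDf m y : B y -> differentiable ('D_(delta_mx 0 m) f) y.
  by have [+ _] := Df (delta_mx 0 m); exact.
pose F m t := v t 0 m *: 'D_(delta_mx 0 m) f (p t).
have dF m : differentiable (F m) x /\ 'D_d (F m) x =
    ('D_d v x) 0 m *: 'D_(delta_mx 0 m) f (p x) +
    v x 0 m *: 'D_('D_d p x) ('D_(delta_mx 0 m) f) (p x).
  have dc := differentiable_comp dp (dDf m _ Bp).
  have [dF DF] := diff_scale (differentiable_entry m dv) dc.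
  by split=> //; rewrite DF (derive_entry d m dv) (derive_comp d dp (dDf m _ Bp)).
have FE : \near x, \sum_m F m x = 'D_(v x) f (p x).
  have cp := differentiable_continuous dp.
  have : \near x, B (p x) by apply: cp; exact: open_nbhs_nbhs.
  by apply: filterS => t /df /derive_coords ->.
have dS : differentiable (fun t => \sum_m F m t) x.
  by apply: differentiable_bigsum => m; have [] := dF m.
split; first exact: near_eq_differentiable FE dS.
apply: etrans (esym (near_eq_derive d FE)) _.
rewrite derive_bigsum; last by move=> m; have [] := dF m.
under eq_bigr do rewrite (dF _).2.
rewrite big_split /= -(derive_coords _ (df _ Bp)); congr (_ + _).
pose Fx m z := v x 0 m *: 'D_(delta_mx 0 m) f z.
have dFx m : differentiable (Fx m) (p x) /\ 'D_('D_d p x) (Fx m) (p x) =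
    v x 0 m *: 'D_('D_d p x) ('D_(delta_mx 0 m) f) (p x).
  have [dFx DFx] := diff_scale (differentiable_cst (v x 0 m : R) (p x))
                      (dDf m _ Bp).
  by split=> //; rewrite DFx derive_cst scale0r add0r.
have FxE : \forall y \near p x, \sum_m Fx m y = 'D_(v x) f y.
  by apply: eq_on_near oB Bp _ => z /df /derive_coords ->.
apply: etrans _ (near_eq_derive _ FxE).
rewrite derive_bigsum; last by move=> m; have [] := dFx m.
by apply: eq_bigr => m _; rewrite (dFx m).2.
Qed.

End Christoffel.

(** * The fibre map and the curvature of the indicatrix *)

(** What the hypotheses say over one point of the manifold, in one chart:
    K and A are the metric function and the Riemannian metric there, z the
    fibre map from the cone D onto the cone D', and z' its inverse. *)
Record homothetic_fibre (R : realType) (n : nat) (A : 'M[R]_n)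
    (K : 'rV[R]_n -> R) (D D' : set 'rV[R]_n) (z z' : 'rV[R]_n -> 'rV[R]_n)
    (h : R) : Prop := HomotheticFibre {
  hf_posdef : posdef A;
  hf_K_gt0 : forall y, y != 0 -> 0 < K y;
  hf_K_hom : forall y (c : R), y != 0 -> 0 < c -> K (c *: y) = c * K y;
  hf_open : open D;
  hf_cod_open : open D';
  hf_neq0 : forall y, D y -> y != 0;
  hf_cone : forall y (c : R), 0 < c -> D y -> D (c *: y);
  hf_map : forall y, D y -> D' (z y) /\ z' (z y) = y;
  hf_inv : forall v, D' v -> D (z' v) /\ z (z' v) = v;
  hf_map_C5 : Ck 5 z D;
  hf_inv_C5 : Ck 5 z' D';
  hf_gt0 : 0 < h;
  hf_hom : forall y (c : R), D y -> 0 < c -> z (c *: y) = c `^ h *: z y;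
  hf_unit : forall y, D y -> (K y = 1 <-> riem_norm A (z y) = 1);
  hf_metric : forall y m l, D y -> fmetric K y m l =
    conformal_factor K h y ^+ 2 *
      \sum_(i < n) \sum_(j < n)
        pder m (fun v => z v 0 i) y * pder l (fun v => z v 0 j) y * A i j
}.

Section Fibre.
Variables (R : realType) (n : nat) (A : 'M[R]_n) (K : 'rV[R]_n -> R)
  (D D' : set 'rV[R]_n) (z z' : 'rV[R]_n -> 'rV[R]_n) (h : R).
Hypothesis F : homothetic_fibre A K D D' z z' h.

Let sA : A^T = A := (hf_posdef F).1.
Let h_gt0 : 0 < h := hf_gt0 F.
Let h_neq0 : h != 0 := lt0r_neq0 h_gt0.

Lemma fibre_differentiable y : D y -> differentiable z y.
Proof. by have [+ _] := hf_map_C5 F; exact. Qed.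

Lemma fibre_inv_differentiable v : D' v -> differentiable z' v.
Proof. by have [+ _] := hf_inv_C5 F; exact. Qed.

Lemma fibre_K_gt0 y : D y -> 0 < K y.
Proof. by move=> /(hf_neq0 F)/(hf_K_gt0 F). Qed.

Lemma fibre_derive_inj y w : D y -> 'D_w z y = 0 -> w = 0.
Proof.
move=> Dy zw0; have [D'zy _] := hf_map F Dy.
have idE : \forall u \near y, z' (z u) = id u.
  by apply: eq_on_near (hf_open F) Dy _ => u /(hf_map F)[].
have := near_eq_derive w idE; rewrite derive_id => <-.
apply: etrans (derive_comp w (fibre_differentiable Dy)
  (fibre_inv_differentiable D'zy)) _.
by rewrite zw0 derive0.
Qed.

Lemma fibre_derive_surj y v : D y -> exists w, 'D_w z y = v.
Proof.
move=> Dy; have [D'zy zzy] := hf_map F Dy; exists ('D_v z' (z y)).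
have idE : \forall u \near z y, z (z' u) = id u.
  by apply: eq_on_near (hf_cod_open F) D'zy _ => u /(hf_inv F)[].
have := near_eq_derive v idE; rewrite derive_id => E; apply: etrans _ E.
have dz : differentiable z (z' (z y)) by rewrite zzy; exact: fibre_differentiable.
apply: etrans _ (esym (derive_comp v (fibre_inv_differentiable D'zy) dz)).
by rewrite zzy.
Qed.

(** Scale y to the indicatrix, where z has norm 1, and use the homogeneity of K
    and of z. *)
Lemma fibre_norm_sqr y : D y -> bform A (z y) (z y) = K y `^ (h *+ 2).
Proof.
move=> Dy; have K0 := fibre_K_gt0 Dy; have y0 := hf_neq0 F Dy.
have Ki0 : 0 < (K y)^-1 by rewrite invr_gt0.
have Dy' := hf_cone F Ki0 Dy.
have K1 : K ((K y)^-1 *: y) = 1 by rewrite (hf_K_hom F)// mulVf// gt_eqF.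
have /(congr1 (fun r => r ^+ 2)) := (hf_unit F Dy').1 K1.
rewrite /riem_norm sqr_sqrtr ?(bform_ge0 _ (hf_posdef F))// expr1n.
rewrite (hf_hom F)// bformZl bformZr mulrA.
have KE : (K y)^-1 `^ h = (K y `^ h)^-1.
  by rewrite -powRN -[in LHS]powR_inv1 ?ltW// -powRrM mulN1r.
rewrite KE -expr2 exprVn => E.
have Kh0 : K y `^ h ^+ 2 != 0 by rewrite expf_neq0// gt_eqF// powR_gt0.
have -> : bform A (z y) (z y) = K y `^ h ^+ 2.
  by apply: (mulfI (invr_neq0 Kh0)); rewrite E mulVf.
by rewrite -mulr_natr powRrM powR_mulrn// powR_ge0.
Qed.

Lemma fibre_unit y : D y -> K y = 1 -> bform A (z y) (z y) = 1.
Proof. by move=> Dy K1; rewrite fibre_norm_sqr// K1 powR1. Qed.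

Lemma bform_fmetric y v w : D y -> bform (fmetric K y) v w =
  conformal_factor K h y ^+ 2 * bform A ('D_v z y) ('D_w z y).
Proof.
move=> Dy; have dz := fibre_differentiable Dy.
rewrite (derive_coords v dz) (derive_coords w dz) bform_suml mulr_sumr.
apply: eq_bigr => m _; rewrite bform_sumr mulr_sumr; apply: eq_bigr => l _.
rewrite bformZl bformZr (hf_metric F)//.
set b := bform _ _ _; set s := \sum_(i < n) _.
have -> : s = b.
  apply: eq_bigr => i _; apply: eq_bigr => j _.
  rewrite /pder (derive_entry _ i dz) (derive_entry _ j dz).
  by rewrite mulrC mulrA.
by move: b (conformal_factor _ _ _) (v 0 m) (w 0 l) => *; ring.
Qed.

Lemma bform_fmetric_indicatrix y v w : D y -> K y = 1 ->
  bform (fmetric K y) v w = h ^- 2 * bform A ('D_v z y) ('D_w z y).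
Proof.
move=> Dy K1; rewrite bform_fmetric// /conformal_factor K1 powR1 mulr1.
by rewrite exprVn.
Qed.

Lemma indicatrix_constant_curvature :
  constant_curvature (fmetric K) (indicatrix K `&` D) (h ^+ 2).
Proof.
move=> V p [oV Cp Sp p_imm] u Vu a b c d g.
have DV v : V v -> D (p v) by move=> /Sp[].
have K1 v : V v -> K (p v) = 1 by move=> /Sp[[_]].
have dp v : V v -> differentiable p v by have [+ _] := Cp; exact.
pose q v := z (p v).
have DqE v w : V v -> 'D_w q v = 'D_('D_w p v) z (p v).
  by move=> Vv; exact: derive_comp (dp _ Vv) (fibre_differentiable (DV _ Vv)).
rewrite -(invrK (h ^+ 2)).
have k0 : h ^- 2 != 0 by rewrite invr_neq0// expf_neq0.
have Cq : Ck 3 q V.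
  exact: Ck_comp oV DV (@Ck_le _ _ _ 3 5 _ _ isT (hf_map_C5 F)) Cp.
have qq v : V v -> bform A (q v) (q v) = 1.
  by move=> Vv; apply: fibre_unit; [exact: DV | exact: K1].
have q_imm v w : V v -> 'D_w q v = 0 -> w = 0.
  move=> Vv; rewrite DqE// => /(fibre_derive_inj (DV _ Vv)).
  exact: p_imm.
have gE v e f : V v -> g v e f =
    h ^- 2 * bform A ('D_(delta_mx 0 e) q v) ('D_(delta_mx 0 f) q v).
  by move=> Vv; rewrite /g mxE (bform_fmetric_indicatrix _ _ (DV _ Vv) (K1 _ Vv))
    !DqE.
exact: (@spherical_curvature R n A (h ^- 2) V q g
  (fun e => 'D_(delta_mx 0 e) q)
  (fun e f => 'D_(delta_mx 0 e) ('D_(delta_mx 0 f) q))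
  (fun e f k => 'D_(delta_mx 0 e)
     ('D_(delta_mx 0 f) ('D_(delta_mx 0 k) q)))
  (hf_posdef F) k0 oV Cq qq q_imm (fun _ _ => erefl) (fun _ _ _ => erefl)
  (fun _ _ _ _ => erefl) gE u a b c d Vu).
Qed.

End Fibre.

(** * Curves on the sphere *)

Section Interval.
Variable R : realType.

Lemma derive_scalar_comp (V : normedModType R) (f : R -> R) (g : V -> R) x df d :
  is_derive (g x) 1 f df -> differentiable g x ->
  differentiable (fun u => f (g u)) x /\
  'D_d (fun u => f (g u)) x = 'D_d g x * df.
Proof.
move=> [df1 fE] dg; have dfg := (derivable1_diffP _ _).1 df1.
split; first exact: differentiable_comp dg dfg.
rewrite (derive_comp d dg dfg).
have := derive_lin ('D_d g x) (1 : R) (0 : R) dfg.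
by rewrite derive0 !addr0 fE /GRing.scale /= mulr1.
Qed.

(** Nothing is known of f outside the segment; at an end point the difference
    quotients from the inner side still determine the derivative. *)
Lemma derive_const_on_segment (f : R -> R) a t : differentiable f t ->
  (forall s, 0 <= s <= 1 -> f s = a) -> 0 <= t <= 1 -> 'D_1 f t = 0.
Proof.
move=> /(derivable1_diffP _ _).2 df fa ht.
apply/eqP; rewrite -normr_le0; apply/ler_addgt0Pl => e e0; rewrite addr0.
have cv : (fun h => h^-1 *: (f (h *: 1 + t) - f t)) @ 0^' --> 'D_1 f t.
  by have := df; rewrite /derivable => /cvgP; exact.
have /(cvgrPdist_lt _ _).1 /(_ _ e0) := cv.
rewrite near_withinE => /nbhs_ballP[r /= r0 rP].
pose d := Num.min (r / 2) 2^-1.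
have d0 : 0 < d by rewrite lt_min divr_gt0//= invr_gt0.
have dr : d < r by rewrite gt_min [X in X || _]ltr_pdivrMr// mulr_natr mulr2n ltrDl r0.
have d2 : d <= 2^-1 by rewrite ge_min lexx orbT.
(* a step towards the inside of the segment *)
pose k := if t <= 2^-1 then d else - d.
have k0 : k != 0 by rewrite /k; case: ifP => _; rewrite ?oppr_eq0 gt_eqF.
have kr : ball 0 r k.
  rewrite -ball_normE /ball_ /= sub0r normrN /k.
  by case: ifP => _; rewrite ?normrN gtr0_norm.
have hk : 0 <= k *: 1 + t <= 1.
  have -> : k *: 1 = k :> R by rewrite /GRing.scale /= mulr1.
  move: ht; rewrite /k; case: (leP t 2^-1) => tt; lra.
have := rP k kr k0; rewrite (fa _ hk) (fa _ ht) subrr scaler0 subr0.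
exact: ltW.
Qed.

Lemma derive0_const_on_segment_real (f : R -> R) :
  (forall t : R, 0 <= t <= 1 -> differentiable f t) ->
  (forall t : R, 0 <= t <= 1 -> 'D_1 f t = 0) ->
  forall t : R, 0 <= t <= 1 -> f t = f 0.
Proof.
move=> df f0 t /andP[t0 t1].
have sub s : s \in `[0, t] -> 0 <= s <= 1.
  by rewrite in_itv /= => /andP[-> st]; exact: le_trans st t1.
have [||s /sub hs] := @MVT_segment R f (fun=> 0) 0 t t0.
- move=> s st; have hs : 0 <= s <= 1 by apply: sub; exact: subset_itv_oo_cc st.
  by apply: DeriveDef; [exact/derivable1_diffP/df | exact: f0].
- apply: derivable_within_continuous => s /sub hs.
  exact/derivable1_diffP/df.
by move/eqP; rewrite mul0r subr_eq0 => /eqP.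
Qed.

Lemma derive0_const_on_segment n (f : R -> 'rV[R]_n) :
  (forall t : R, 0 <= t <= 1 -> differentiable f t) ->
  (forall t : R, 0 <= t <= 1 -> 'D_1 f t = 0) ->
  forall t : R, 0 <= t <= 1 -> f t = f 0.
Proof.
move=> df f0 t ht; apply/rowP => m.
apply: (@derive0_const_on_segment_real (fun s => f s 0 m)) ht => s hs.
  exact/differentiable_entry/df.
by rewrite (derive_entry _ _ (df _ hs)) f0// mxE.
Qed.

End Interval.

Section GreatCircle.
Variables (R : realType) (n : nat) (A : 'M[R]_n) (q : R -> 'rV[R]_n).
Hypotheses (pA : posdef A)
  (dq : forall t : R, 0 <= t <= 1 -> differentiable q t)
  (dq' : forall t : R, 0 <= t <= 1 -> differentiable ('D_1 q) t)
  (qq : forall t : R, 0 <= t <= 1 -> bform A (q t) (q t) = 1)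
  (q'' : forall t : R, 0 <= t <= 1 -> forall x, bform A (q t) x = 0 ->
     bform A x ('D_1 ('D_1 q) t) = 0).

Let sA : A^T = A := pA.1.

Lemma sphere_velocity t : 0 <= t <= 1 -> bform A (q t) ('D_1 q t) = 0.
Proof.
move=> ht; have [db Db] := diff_bform A (dq ht) (dq ht).
have := derive_const_on_segment db qq ht.
rewrite Db (bformC ('D_1 q t) _ sA) => /eqP.
by rewrite -mulr2n mulrn_eq0 => /eqP.
Qed.

(** The acceleration is normal, and its normal component is obtained by
    differentiating <q, q'> = 0. *)
Lemma sphere_acceleration t : 0 <= t <= 1 ->
  'D_1 ('D_1 q) t = - bform A ('D_1 q t) ('D_1 q t) *: q t.
Proof.
move=> ht; have [db Db] := diff_bform A (dq ht) (dq' ht).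
have := derive_const_on_segment db sphere_velocity ht; rewrite Db => E.
pose x := 'D_1 ('D_1 q) t + bform A ('D_1 q t) ('D_1 q t) *: q t.
have qx : bform A (q t) x = 0 by rewrite bformDr bformZr qq// mulr1 addrC.
have x0 : x = 0.
  apply: (bform_eq0 pA); rewrite {2}/x bformDr q''// bformZr (bformC x _ sA) qx.
  by rewrite mulr0 addr0.
by apply/eqP; rewrite scaleNr -addr_eq0 -/x x0.
Qed.

Lemma sphere_speed t : 0 <= t <= 1 ->
  bform A ('D_1 q t) ('D_1 q t) = bform A ('D_1 q 0) ('D_1 q 0).
Proof.
apply: (@derive0_const_on_segment_real R
  (fun t => bform A ('D_1 q t) ('D_1 q t))) => s hs;
  have [db Db] := diff_bform A (dq' hs) (dq' hs); first exact: db.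
rewrite Db sphere_acceleration// bformZl bformZr (bformC ('D_1 q s) _ sA).
by rewrite sphere_velocity// mulr0 addr0.
Qed.

(** The speed L is constant, so q'' = - L^2 q, and
    cos(Lt) q - sin(Lt) q' / L and sin(Lt) q + cos(Lt) q' / L have derivative 0.
    For L = 0 the vector e is 0 and the curve is constant. *)
Lemma great_circle : exists (L : R) (e : 'rV[R]_n), [/\ 0 <= L,
  (forall t : R, 0 <= t <= 1 -> bform A ('D_1 q t) ('D_1 q t) = L ^+ 2),
  L != 0 -> bform A e e = 1, bform A (q 0) e = 0 &
  forall t : R, 0 <= t <= 1 -> q t = cos (L * t) *: q 0 + sin (L * t) *: e].
Proof.
have h0 : 0 <= (0 : R) <= 1 by rewrite lexx ler01.
pose L := Num.sqrt (bform A ('D_1 q 0) ('D_1 q 0)).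
have LE : L ^+ 2 = bform A ('D_1 q 0) ('D_1 q 0).
  by rewrite sqr_sqrtr// (bform_ge0 _ pA).
have EL (t : R) : 0 <= t <= 1 -> bform A ('D_1 q t) ('D_1 q t) = L ^+ 2.
  by move=> ht; rewrite sphere_speed.
exists L, (L^-1 *: 'D_1 q 0); split => //; first exact: sqrtr_ge0.
- by move=> L0; rewrite bformZl bformZr -LE expr2 mulKf// mulVf.
- by rewrite bformZr sphere_velocity// mulr0.
have [L0 t ht|L0 t ht] := eqVneq L 0.
  rewrite L0 mul0r cos0 sin0 scale1r scale0r addr0.
  apply: derive0_const_on_segment ht => // s hs.
  by apply: (bform_eq0 pA); rewrite EL// L0 expr0n.
have dLt (s : R) : is_derive s 1 (fun s : R => L * s) L.
  have [d D] := diff_cmul L (ex_diff : differentiable (id : R -> R) s).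
  by apply: DeriveDef; [exact/derivable1_diffP | rewrite D derive_id mulr1].
have dcos (s : R) : differentiable (fun s => cos (L * s)) s /\
    'D_1 (fun s => cos (L * s)) s = - L * sin (L * s).
  have [d1 D1] := dLt s.
  have [d D] := derive_scalar_comp (1 : R) (is_derive_cos (L * s))
    ((derivable1_diffP _ _).1 d1).
  by split=> //; rewrite D D1 mulrN mulNr.
have dsin (s : R) : differentiable (fun s => sin (L * s)) s /\
    'D_1 (fun s => sin (L * s)) s = L * cos (L * s).
  have [d1 D1] := dLt s.
  have [d D] := derive_scalar_comp (1 : R) (is_derive_sin (L * s))
    ((derivable1_diffP _ _).1 d1).
  by split=> //; rewrite D D1.
(* the pairs (cos, - sin / L) and (sin, cos / L) both satisfy the hypotheses *)
have const (f g : R -> R) : (forall s, differentiable f s) ->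
    (forall s, differentiable g s) ->
    (forall s, 'D_1 f s = L * L * g s) -> (forall s, 'D_1 g s = - f s) ->
    f t *: q t + g t *: 'D_1 q t = f 0 *: q 0 + g 0 *: 'D_1 q 0.
  move=> df dg Df Dg.
  pose X s := f s *: q s + g s *: 'D_1 q s.
  rewrite -/(X t) -/(X 0); apply: derive0_const_on_segment ht => s hs.
    have [d1 _] := diff_scale (df s) (dq hs).
    have [d2 _] := diff_scale (dg s) (dq' hs).
    exact: differentiable_add.
  have [d1 D1] := diff_scale (df s) (dq hs).
  have [d2 D2] := diff_scale (dg s) (dq' hs).
  rewrite derive_add// D1 D2 Df Dg sphere_acceleration// EL// expr2.
  rewrite !scaleNr scalerN scalerA (mulrC (g s)) -opprD [X in X - _]addrC.
  by rewrite subrr.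
have C1 : cos (L * t) *: q t + (- L^-1 * sin (L * t)) *: 'D_1 q t = q 0.
  rewrite (const (fun s => cos (L * s)) (fun s => - L^-1 * sin (L * s))).
  - by rewrite mulr0 cos0 sin0 mulr0 scale1r scale0r addr0.
  - by move=> s; have [] := dcos s.
  - by move=> s; have [] := diff_cmul (- L^-1) (dsin s).1.
  - by move=> s; rewrite (dcos s).2; field.
  - move=> s; rewrite (diff_cmul (- L^-1) (dsin s).1).2 (dsin s).2.
    by rewrite mulrA mulNr mulVf// mulN1r.
have C2 : sin (L * t) *: q t + (L^-1 * cos (L * t)) *: 'D_1 q t =
    L^-1 *: 'D_1 q 0.
  rewrite (const (fun s => sin (L * s)) (fun s => L^-1 * cos (L * s))).
  - by rewrite mulr0 cos0 sin0 mulr1 scale0r add0r.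
  - by move=> s; have [] := dsin s.
  - by move=> s; have [] := diff_cmul (L^-1) (dcos s).1.
  - by move=> s; rewrite (dsin s).2; field.
  - move=> s; rewrite (diff_cmul (L^-1) (dcos s).1).2 (dcos s).2.
    by rewrite mulrA mulrN mulVf// mulN1r.
rewrite -C1 -C2 !scalerDr !scalerA addrACA -!scalerDl -!expr2 cos2Dsin2 scale1r.
rewrite -[LHS]addr0; congr (_ + _); rewrite -[LHS](scale0r ('D_1 q t)).
by congr (_ *: _); ring.
Qed.

End GreatCircle.

(** * Geodesics of the indicatrix *)

Lemma bform_delta (R : realType) (n : nat) (A : 'M[R]_n) l m :
  bform A (delta_mx 0 l) (delta_mx 0 m) = A l m.
Proof. by rewrite bformE trmx_delta -rowE -colE !mxE. Qed.

Lemma bform_expand (R : realType) (n : nat) (A : 'M[R]_n) v w :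
  bform A v w = \sum_m v 0 m * (\sum_l A m l * w 0 l).
Proof.
apply: eq_bigr => m _; rewrite mulr_sumr; apply: eq_bigr => l _.
by rewrite mulrCA mulrA.
Qed.

(** The Koszul formula for the pull-back of a flat metric: all second
    derivatives but vv, the second derivative along the velocity, cancel. *)
Lemma koszul (R : realType) (n : nat) (A : 'M[R]_n) (k : R)
    (w acc v vv vw wv : 'rV[R]_n) : A^T = A -> vw = wv ->
  k * bform A w acc + (k * (bform A vv w + bform A v vw)
    - 2^-1 * (k * (bform A wv v + bform A v wv))) = k * bform A w (acc + vv).
Proof.
move=> sA ->; rewrite bformDr (bformC wv _ sA) (bformC vv _ sA).
by move: (bform _ _ _) (bform _ _ _) (bform _ _ _) => a b c; field.
Qed.

Section FibreGeodesic.
Variables (R : realType) (n : nat) (A : 'M[R]_n) (K : 'rV[R]_n -> R)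
  (D D' : set 'rV[R]_n) (z z' : 'rV[R]_n -> 'rV[R]_n) (h : R).
Hypothesis F : homothetic_fibre A K D D' z z' h.

Let sA : A^T = A := (hf_posdef F).1.
Let h_gt0 : 0 < h := hf_gt0 F.
Let h_neq0 : h != 0 := lt0r_neq0 h_gt0.

(** Near y the function K is <z, z> to the power 1 / (2h), by
    [fibre_norm_sqr]. *)
Lemma derive_K y w : D y -> K y = 1 -> differentiable K y /\
  'D_w K y = h^-1 * bform A (z y) ('D_w z y).
Proof.
move=> Dy K1; have dz := fibre_differentiable F Dy.
have [db Db] := diff_bform A dz dz.
pose r := (h *+ 2)^-1.
have b1 := fibre_unit F Dy K1.
have KE : \forall u \near y, bform A (z u) (z u) `^ r = K u.
  apply: eq_on_near (hf_open F) Dy _ => u Du.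
  rewrite (fibre_norm_sqr F Du) -powRrM divff ?mulrn_eq0//.
  by rewrite powRr1// ltW// (fibre_K_gt0 F Du).
have b0 : 0 < bform A (z y) (z y) by rewrite b1.
have [dp Dp] := @derive_scalar_comp R _ _ (fun u => bform A (z u) (z u)) y _ w
  (is_derive1_powR r b0) db.
split; first exact: near_eq_differentiable KE dp.
apply: etrans (esym (near_eq_derive w KE)) _.
rewrite Dp Db b1 powR1 mulr1 (bformC ('D_w z y) _ sA) /r.
by field.
Qed.

Let mu y := conformal_factor K h y ^+ 2.

Let derive_mu y w : D y -> K y = 1 -> differentiable mu y /\
  ('D_w K y = 0 -> 'D_w mu y = 0).
Proof.
move=> Dy K1; have [dK _] := derive_K w Dy K1.
have K0 : 0 < K y by rewrite K1.
have [dp Dp] := derive_scalar_comp w (is_derive1_powR (1 - h) K0) dK.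
have [dc Dc] := diff_cmul h^-1 dp.
have [dcc Dcc] := diff_scale dc dc.
have E : (fun u => (h^-1 * K u `^ (1 - h)) *: (h^-1 * K u `^ (1 - h) : R)) = mu.
  by apply/funext => u; rewrite /mu expr2.
rewrite E in dcc Dcc; split=> // DK.
by rewrite Dcc Dc Dp DK mul0r mulr0 scale0r scaler0 addr0.
Qed.

Let Cz : Ck 2 z D := Ck_le (isT : (2 <= 5)%N) (hf_map_C5 F).

Let dDz x y : D y -> differentiable ('D_x z) y.
Proof. by have [_ /(_ x) [+ _]] := Cz; exact. Qed.

Let derive_G y x x' d : D y -> K y = 1 ->
  differentiable (fun u => bform (fmetric K u) x x') y /\
  ('D_d K y = 0 -> 'D_d (fun u => bform (fmetric K u) x x') y =
    h ^- 2 * (bform A ('D_d ('D_x z) y) ('D_x' z y) +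
              bform A ('D_x z y) ('D_d ('D_x' z) y))).
Proof.
move=> Dy K1.
have GE : \forall u \near y, mu u *: (bform A ('D_x z u) ('D_x' z u) : R) =
    bform (fmetric K u) x x'.
  apply: eq_on_near (hf_open F) Dy _ => u Du.
  by rewrite (bform_fmetric F _ _ Du).
have [dm Dm] := derive_mu d Dy K1.
have [db Db] := diff_bform A (dDz x Dy) (dDz x' Dy).
have [dp Dp] := diff_scale dm db.
split=> [|DK]; first exact: near_eq_differentiable GE dp.
apply: etrans (esym (near_eq_derive d GE)) _.
rewrite Dp Db (Dm DK) scale0r add0r; congr (_ *: _).
by rewrite /mu /conformal_factor K1 powR1 mulr1 exprVn.
Qed.

(** The left-hand side is the covariant acceleration in the direction w of a
    curve through y with velocity v and second derivative acc.  In tangential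
    directions the derivatives of the conformal factor, a function of K, vanish;
    what remains is h^-2 times the second derivative of the image curve. *)
Lemma fibre_covariant_acceleration y (v acc w : 'rV[R]_n) : D y -> K y = 1 ->
  'D_v K y = 0 -> 'D_w K y = 0 ->
  \sum_(m < n) w 0 m *
    (\sum_(l < n) fmetric K y m l * acc 0 l +
     \sum_(k < n) \sum_(l < n)
       christoffel (fmetric K) k l m y * v 0 k * v 0 l) =
  h ^- 2 * bform A ('D_w z y) ('D_acc z y + 'D_v ('D_v z) y).
Proof.
move=> Dy K1 vK wK.
have dG l m : differentiable (fun u => fmetric K u l m) y.
  have [+ _] := derive_G (delta_mx 0 l) (delta_mx 0 m) 0 Dy K1.
  by rewrite (_ : (fun u => bform _ _ _) = (fun u => fmetric K u l m))//;
    apply/funext => u; rewrite bform_delta.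
under eq_bigr do rewrite mulrDr.
rewrite big_split /= christoffel_contraction//.
rewrite -bform_expand.
have sw : 'D_v ('D_w z) y = 'D_w ('D_v z) y := schwarz _ _ (hf_open F) Dy Cz.
apply: etrans (congr2 +%R (bform_fmetric_indicatrix F w acc Dy K1)
  (congr2 (fun a b => a - 2^-1 * b) ((derive_G v w v Dy K1).2 vK)
                                    ((derive_G v v w Dy K1).2 wK))) _.
exact: koszul sA sw.
Qed.

Variables (U : set 'rV[R]_n) (c : R -> 'rV[R]_n) (O : set R).
Hypotheses (UD : U `<=` D) (UK : U `<=` indicatrix K) (oO : open O)
  (O01 : `[0, 1]%classic `<=` O) (Cc : Ck 2 c O)
  (Uc : forall t : R, 0 <= t <= 1 -> U (c t)) (gc : geodesic K c).

Let q t := z (c t).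

Let Dc (t : R) : 0 <= t <= 1 -> D (c t). Proof. by move=> /Uc/UD. Qed.

Let Kc (t : R) : 0 <= t <= 1 -> K (c t) = 1. Proof. by move=> /Uc/UK[]. Qed.

Let O_of (t : R) : 0 <= t <= 1 -> O t.
Proof. by move=> ht; apply: O01; rewrite /= in_itv. Qed.

Let dc t : O t -> differentiable c t.
Proof. by have [+ _] := Cc; exact. Qed.

Let dc' t : O t -> differentiable ('D_1 c) t.
Proof. by have [_ /(_ (1 : R)) [+ _]] := Cc; exact. Qed.

Let near_O (t : R) : 0 <= t <= 1 -> \forall s \near t, O s /\ D (c s).
Proof.
move=> ht; have Ot := O_of ht.
have cc := differentiable_continuous (dc Ot).
apply: filterI; first exact: open_nbhs_nbhs.
apply: cc; apply: open_nbhs_nbhs; split; [exact: hf_open F | exact: Dc].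
Qed.

Lemma derive_image (t : R) : 0 <= t <= 1 ->
  \forall s \near t, 'D_('D_1 c s) z (c s) = 'D_1 q s.
Proof.
move=> /near_O; apply: filterS => s [Os Ds].
exact/esym/(derive_comp (1 : R) (dc Os) (fibre_differentiable F Ds)).
Qed.

Lemma image_differentiable (t : R) : 0 <= t <= 1 -> differentiable q t.
Proof.
move=> ht; exact: differentiable_comp (dc (O_of ht))
  (fibre_differentiable F (Dc ht)).
Qed.

Lemma image_velocity_differentiable (t : R) : 0 <= t <= 1 ->
  differentiable ('D_1 q) t /\ 'D_1 ('D_1 q) t =
    'D_('D_1 ('D_1 c) t) z (c t) + 'D_('D_1 c t) ('D_('D_1 c t) z) (c t).
Proof.
move=> ht; have Ot := O_of ht.
have [d E] := derive_along (1 : R) (hf_open F) Cz (Dc ht) (dc Ot) (dc' Ot).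
split; first exact: near_eq_differentiable (derive_image ht) d.
by rewrite -E; apply/esym/near_eq_derive; exact: derive_image.
Qed.

Lemma image_unit (t : R) : 0 <= t <= 1 -> bform A (q t) (q t) = 1.
Proof. move=> ht; exact (fibre_unit F (Dc ht) (Kc ht)). Qed.

(** A vector x orthogonal to q t is D_w z for some w, which is tangent to the
    indicatrix because D_w K = h^-1 <q t, x>; the geodesic equation applies
    to w. *)
Lemma image_acceleration (t : R) : 0 <= t <= 1 ->
  forall x, bform A (q t) x = 0 -> bform A x ('D_1 ('D_1 q) t) = 0.
Proof.
move=> ht x qx.
have [w wE] := fibre_derive_surj F x (Dc ht).
have wK : 'D_w K (c t) = 0.
  by rewrite (derive_K w (Dc ht) (Kc ht)).2 wE qx mulr0.
have vK : 'D_('D_1 c t) K (c t) = 0.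
  rewrite (derive_K _ (Dc ht) (Kc ht)).2 (nbhs_singleton (derive_image ht)).
  have := sphere_velocity (hf_posdef F) image_differentiable image_unit ht.
  by rewrite /q => ->; rewrite mulr0.
have := gc ht wK.
have E1 : derive1 c = 'D_1 c by apply/funext => s; exact: derive1E.
have E2 : derive1 ('D_1 c) = 'D_1 ('D_1 c).
  by apply/funext => s; exact: derive1E.
rewrite E1 E2.
rewrite (fibre_covariant_acceleration _ (Dc ht) (Kc ht) vK wK) => /eqP.
rewrite mulf_eq0 invr_eq0 expf_eq0 (negPf h_neq0) andbF /= => /eqP.
by rewrite wE (image_velocity_differentiable ht).2.
Qed.

Lemma geodesic_great_circle : exists (L : R) (e : 'rV[R]_n), [/\ 0 <= L,
  L != 0 -> bform A e e = 1, bform A (z (c 0)) e = 0,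
  (forall t : R, 0 <= t <= 1 ->
     z (c t) = cos (L * t) *: z (c 0) + sin (L * t) *: e) &
  curve_length (fmetric K) c = h^-1 * L].
Proof.
have [L [e [L0 L2 ee qe qE]]] := great_circle (hf_posdef F)
  image_differentiable (fun t ht => (image_velocity_differentiable ht).1)
  image_unit image_acceleration.
exists L, e; split => //.
have hL : 0 <= h^-1 * L by rewrite mulr_ge0// invr_ge0 ltW.
rewrite /curve_length; under eq_Rintegral => t.
  rewrite inE /= in_itv /= => ht.
  rewrite derive1E (bform_fmetric_indicatrix F _ _ (Dc ht) (Kc ht)).
  rewrite (nbhs_singleton (derive_image ht)) L2// -exprVn -exprMn sqrtr_sqr.
  rewrite (ger0_norm hL).
  over.
rewrite Rintegral_cst//= lebesgue_measure_itv /= lte_fin ltr01.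
by rewrite EFinN sube0 mulr1.
Qed.

End FibreGeodesic.

(** * Shortening great circle arcs longer than pi *)

Section Detour.
Variable R : realType.

(** Two linear equations in n > 2 unknowns have a nonzero solution. *)
Lemma orthonormal_third n (A : 'M[R]_n) (e1 e2 : 'rV[R]_n) :
  posdef A -> (2 < n)%N -> exists e3 : 'rV[R]_n,
  [/\ bform A e3 e3 = 1, bform A e3 e1 = 0 & bform A e3 e2 = 0].
Proof.
move=> pA n2.
pose B := row_mx (A *m e1^T) (A *m e2^T).
have kB : kermx B != 0.
  rewrite -mxrank_eq0 mxrank_ker -lt0n subn_gt0.
  exact: leq_ltn_trans (rank_leq_col B) n2.
have [v /sub_kermxP vB v0] : exists2 v : 'rV[R]_n, (v <= kermx B)%MS & v != 0.
  by exists (nz_row (kermx B)); [exact: nz_row_sub | rewrite nz_row_eq0].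
have [v1 v2] : bform A v e1 = 0 /\ bform A v e2 = 0.
  move: vB; rewrite mul_mx_row -[RHS]row_mx0 => /eq_row_mx[E1 E2].
  by rewrite !bformE -!mulmxA E1 E2 !mxE.
have vv := pA.2 v v0.
exists ((Num.sqrt (bform A v v))^-1 *: v); split.
- rewrite bformZl bformZr mulrA -invfM -expr2 sqr_sqrtr ?ltW// mulVf//.
  by rewrite gt_eqF.
- by rewrite bformZl v1 mulr0.
- by rewrite bformZl v2 mulr0.
Qed.

Lemma Ck1_real (f f' : R -> R) (O : set R) :
  (forall t : R, is_derive t 1 f (f' t)) -> continuous f' -> Ck 1 f O.
Proof.
move=> ff' cf'; have df (t : R) : differentiable f t.
  by apply/derivable1_diffP; have [] := ff' t.
split=> [t _|v]; first exact: df.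
have -> : (fun t => 'D_v f t) = (fun t => v * f' t).
  apply/funext => t; have := derive_lin v (1 : R) (0 : R) (df t).
  by rewrite derive0 !addr0 (ff' t).(derive_val) /GRing.scale /= mulr1.
by move=> t _; apply: cvgM; [exact: cvg_cst | exact: cf'].
Qed.

Lemma is_derive_mull (k t : R) : is_derive t 1 (fun s : R => k * s) k.
Proof.
have [d D] := diff_cmul k (ex_diff : differentiable (id : R -> R) t).
by apply: DeriveDef; [exact/derivable1_diffP | rewrite D derive_id mulr1].
Qed.

Lemma is_derive_comp_real (f g : R -> R) (t df dg : R) :
  is_derive (g t) 1 f df -> is_derive t 1 g dg ->
  is_derive t 1 (fun s => f (g s)) (dg * df).
Proof.
move=> Df [d1 <-]; have dg1 := (derivable1_diffP _ _).1 d1.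
have [d D] := derive_scalar_comp (1 : R) Df dg1.
by apply: DeriveDef; [exact/derivable1_diffP | exact: D].
Qed.

Lemma continuous_mull (k : R) : continuous (fun s : R => k * s).
Proof. by move=> t; apply: cvgM; [exact: cvg_cst | exact: cvg_id]. Qed.

(** The derivative of sin at 0 is 1 > k. *)
Lemma sin_sqr_lower_bound (k : R) : 0 < k < 1 -> exists2 d : R, 0 < d &
  forall y : R, `|y| < d -> k ^+ 2 * y ^+ 2 <= sin y ^+ 2.
Proof.
move=> /andP[k0 k1].
have [ds Ds] := is_derive_sin (0 : R).
have cv : (fun y => y^-1 *: (sin (y *: 1 + 0) - sin 0)) @ 0^' --> (1 : R).
  by rewrite -[X in _ --> X](cos0 R) -Ds; have := ds; rewrite /derivable => /cvgP; exact.
have k10 : 0 < 1 - k by rewrite subr_gt0.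
have /(cvgrPdist_lt _ _).1 /(_ _ k10) := cv.
rewrite near_withinE => /nbhs_ballP[d /= d0 dP].
exists d => // y yd.
have [->|y0] := eqVneq y 0; first by rewrite expr0n mulr0 sqr_ge0.
have := dP y; rewrite -ball_normE /ball_ /= sub0r normrN => /(_ yd y0).
have -> : y *: 1 = y :> R by rewrite /GRing.scale /= mulr1.
rewrite addr0 sin0 subr0 => H.
have : k < sin y / y.
  by move: H; rewrite /GRing.scale /= (mulrC y^-1) ltr_norml => /andP[]; lra.
move=> kl; have : k ^+ 2 <= (sin y / y) ^+ 2 by rewrite lerXn2r ?nnegrE// ltW// (lt_trans k0).
by rewrite expr_div_n ler_pdivlMr// exprn_even_gt0.
Qed.

Lemma integral_cos_wave (a b : R) :
  \int[lebesgue_measure]_(t in `[0, 1]) (a + b * cos (2 * pi * t)) = a.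
Proof.
have p0 : (2 * pi : R) != 0 by rewrite mulf_neq0// ?gt_eqF// pi_gt0.
pose f t := a + b * cos (2 * pi * t).
pose G t := a * t + (b / (2 * pi)) * sin (2 * pi * t).
have DG (t : R) : is_derive t 1 G (f t).
  apply: (is_derive_eq (is_deriveD (is_derive_mull a t)
    (is_deriveZ (b / (2 * pi)) (is_derive_comp_real (is_derive_sin _)
       (is_derive_mull (2 * pi) t))))).
  by rewrite /f /GRing.scale /=; congr (_ + _); rewrite mulrA divfK.
have cf : continuous f.
  move=> t; apply: cvgD; first exact: cvg_cst.
  apply: cvgM; first exact: cvg_cst.
  apply: (@continuous_comp _ _ _ (fun s : R => 2 * pi * s) cos t).
    exact: continuous_mull.
  exact: continuous_cos.
have cG : continuous G.
  by move=> t; apply/differentiable_continuous/derivable1_diffP; have [] := DG t.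
have : (\int[lebesgue_measure]_(t in `[0%R, 1%R]) (f t)%:E = (G 1)%:E - (G 0)%:E)%E.
  apply: continuous_FTC2 => //.
  - exact: continuous_subspaceT.
  - split; first by move=> t _; have [] := DG t.
    + by apply: cvg_at_right_filter; exact: cG.
    + by apply: cvg_at_left_filter; exact: cG.
  - by move=> t _; rewrite derive1E; have [] := DG t.
rewrite /Rintegral /f => ->; rewrite /G /= !mulr1 !mulr0 sin0 mulr0.
have -> : sin (2 * pi) = 0 :> R by rewrite mulr_natl sin2pi.
by rewrite mulr0 !addr0 subr0.
Qed.

End Detour.

Section DetourCurve.
Variables (R : realType) (n : nat).

(** The great circle arc lifted to the latitude eps sin(pi t).  The latitude
    sin(pi t) is the first eigenfunction of the second variation of length with
    fixed ends, on which that variation is negative as soon as L > pi; writing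
    it as an angle keeps the curve on the sphere. *)
Definition detour (e1 e2 e3 : 'rV[R]_n) (L eps t : R) : 'rV[R]_n :=
  cos (eps * sin (pi * t)) *: (cos (L * t) *: e1 + sin (L * t) *: e2) +
  sin (eps * sin (pi * t)) *: e3.

Variables (A : 'M[R]_n) (e1 e2 e3 : 'rV[R]_n) (L : R).
Hypotheses (pA : posdef A)
  (e11 : bform A e1 e1 = 1) (e22 : bform A e2 e2 = 1) (e33 : bform A e3 e3 = 1)
  (e12 : bform A e1 e2 = 0) (e31 : bform A e3 e1 = 0) (e32 : bform A e3 e2 = 0).

Let sA : A^T = A := pA.1.

Lemma bform_orthonormal a1 a2 a3 :
  bform A (a1 *: e1 + a2 *: e2 + a3 *: e3) (a1 *: e1 + a2 *: e2 + a3 *: e3) =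
  a1 ^+ 2 + a2 ^+ 2 + a3 ^+ 2.
Proof.
rewrite !(bformDl, bformDr, bformZl, bformZr) e11 e22 e33 e31 e32 e12.
rewrite (bformC e2 e1 sA) (bformC e1 e3 sA) (bformC e2 e3 sA) e12 e31 e32.
by ring.
Qed.

Lemma detourE eps t : detour e1 e2 e3 L eps t =
  (cos (eps * sin (pi * t)) * cos (L * t)) *: e1 +
  (cos (eps * sin (pi * t)) * sin (L * t)) *: e2 +
  sin (eps * sin (pi * t)) *: e3.
Proof. by rewrite /detour scalerDr !scalerA. Qed.

Lemma detour_unit eps t :
  bform A (detour e1 e2 e3 L eps t) (detour e1 e2 e3 L eps t) = 1.
Proof.
rewrite detourE bform_orthonormal !exprMn -mulrDr cos2Dsin2 mulr1.
exact: cos2Dsin2.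
Qed.

Lemma detour0 t : detour e1 e2 e3 L 0 t = cos (L * t) *: e1 + sin (L * t) *: e2.
Proof. by rewrite /detour mul0r cos0 sin0 scale1r scale0r addr0. Qed.

Lemma detour_start eps : detour e1 e2 e3 L eps 0 = detour e1 e2 e3 L 0 0.
Proof. by rewrite /detour !(mulr0, sin0). Qed.

Lemma detour_end eps : detour e1 e2 e3 L eps 1 = detour e1 e2 e3 L 0 1.
Proof. by rewrite /detour !mulr1 sinpi !mulr0. Qed.

Let phi eps (t : R) : R := eps * sin (pi * t).

Let dphi eps (t : R) :
  is_derive t 1 (phi eps) (eps * (pi * cos (pi * t))).
Proof.
exact: (is_derive_eq (is_deriveZ eps (is_derive_comp_real (is_derive_sin _)
  (is_derive_mull pi t)))).
Qed.

Let cont_comp (f g : R -> R) : continuous f -> continuous g ->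
  continuous (fun t => f (g t)).
Proof. by move=> cf cg t; apply: continuous_comp; [exact: cg | exact: cf]. Qed.

Let cont_mul (f g : R -> R) : continuous f -> continuous g ->
  continuous (fun t => f t * g t).
Proof. by move=> cf cg t; apply: cvgM; [exact: cf | exact: cg]. Qed.

Let cont_lin (f : R -> R) (k : R) : continuous f ->
  continuous (fun t : R => f (k * t)).
Proof. by move=> cf; apply: cont_comp => //; exact: continuous_mull. Qed.

Let cont_cst (k : R) : continuous (fun _ : R => k).
Proof. by move=> t; exact: cvg_cst. Qed.

Let cont_phi eps : continuous (phi eps).
Proof. exact/cont_mul/cont_lin/continuous_sin. Qed.

Let cont_dphi (eps : R) : continuous (fun t : R => eps * (pi * cos (pi * t))).
Proof.
have c1 := cont_lin (k := pi) (@continuous_cos R).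
exact (cont_mul (@cont_cst eps) (cont_mul (@cont_cst pi) c1)).
Qed.

Let contN (f : R -> R) : continuous f -> continuous (fun t => - f t).
Proof. by move=> cf t; apply: cvgN; exact: cf. Qed.

Let dcosphi eps (t : R) := is_derive_comp_real (is_derive_cos (phi eps t)) (dphi eps t).
Let dsinphi eps (t : R) := is_derive_comp_real (is_derive_sin (phi eps t)) (dphi eps t).
Let dcosL (t : R) := is_derive_comp_real (is_derive_cos (L * t)) (is_derive_mull L t).
Let dsinL (t : R) := is_derive_comp_real (is_derive_sin (L * t)) (is_derive_mull L t).

Lemma detour_Ck eps O : open O -> Ck 1 (detour e1 e2 e3 L eps) O.
Proof.
move=> oO.
have c1 := Ck1_real O (dcosphi eps)
  (cont_mul (@cont_dphi eps) (contN (cont_comp (@continuous_sin R) (@cont_phi eps)))).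
have c2 := Ck1_real O (dsinphi eps)
  (cont_mul (@cont_dphi eps) (cont_comp (@continuous_cos R) (@cont_phi eps))).
have c3 := Ck1_real O dcosL
  (cont_mul (@cont_cst L) (contN (cont_lin (@continuous_sin R)))).
have c4 := Ck1_real O dsinL
  (cont_mul (@cont_cst L) (cont_lin (@continuous_cos R))).
exact: (Ck_add oO
  (Ck_scale oO c1 (Ck_add oO (Ck_scale oO c3 (Ck_cst 1 e1 O))
                             (Ck_scale oO c4 (Ck_cst 1 e2 O))))
  (Ck_scale oO c2 (Ck_cst 1 e3 O))).
Qed.

Definition detour_speed_sqr eps (t : R) : R :=
  (eps * (pi * cos (pi * t))) ^+ 2 + (L * cos (eps * sin (pi * t))) ^+ 2.

Lemma detour_speedE eps t :
  bform A ('D_1 (detour e1 e2 e3 L eps) t) ('D_1 (detour e1 e2 e3 L eps) t) =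
  detour_speed_sqr eps t.
Proof.
have dS (f : R -> R) (g : R -> 'rV[R]_n) df dg : is_derive t 1 f df ->
    is_derive t 1 g dg ->
    is_derive t 1 (fun s => f s *: g s) (df *: g t + f t *: dg).
  move=> [d1 D1] [d2 D2].
  have [d D] := diff_scale ((derivable1_diffP _ _).1 d1)
                           ((derivable1_diffP _ _).1 d2).
  by apply: DeriveDef; [exact/derivable1_diffP | rewrite D D1 D2].
have H := is_deriveD
  (dS _ _ _ _ (dcosphi eps t)
    (is_deriveD (dS _ _ _ _ (dcosL t) (is_derive_cst e1 t (1 : R)))
                (dS _ _ _ _ (dsinL t) (is_derive_cst e2 t (1 : R)))))
  (dS _ _ _ _ (dsinphi eps t) (is_derive_cst e3 t (1 : R))).
have -> : 'D_1 (detour e1 e2 e3 L eps) t = _ := @derive_val _ _ _ _ _ _ _ H.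
rewrite !scaler0 !addr0 /phi /detour_speed_sqr !fctE /=.
set u := eps * _; set s := eps * _.
rewrite !scalerDr !scalerA addrACA -!scalerDl bform_orthonormal.
have := cos2Dsin2 (L * t); have := cos2Dsin2 s.
rewrite -/s; move: (cos s) (sin s) (cos (L * t)) (sin (L * t)) => a b c d E1 E2.
transitivity (u ^+ 2 * b ^+ 2 * (c ^+ 2 + d ^+ 2) +
  (L * a) ^+ 2 * (c ^+ 2 + d ^+ 2) + u ^+ 2 * a ^+ 2); first by ring.
rewrite E2 !mulr1 addrAC -mulrDr (addrC (b ^+ 2)) E1 mulr1.
by [].
Qed.

End DetourCurve.

Section DetourLength.
Variable R : realType.

Lemma segment_integrable (f : R -> R) : continuous f ->
  lebesgue_measure.-integrable `[0, 1] (EFin \o f).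
Proof.
move=> cf; apply: continuous_compact_integrable; first exact: segment_compact.
exact: continuous_subspaceT.
Qed.

Lemma continuous_detour_speed (L eps : R) :
  continuous (fun t => Num.sqrt (detour_speed_sqr L eps t)).
Proof.
move=> t; apply: (@continuous_comp _ _ _ (detour_speed_sqr L eps) Num.sqrt);
  last exact: sqrt_continuous.
have cm (f : R -> R) (k : R) : continuous f ->
    {for t, continuous (fun s : R => f (k * s))}.
  move=> cf; apply: (@continuous_comp _ _ _ (fun s : R => k * s) f).
    exact: continuous_mull.
  exact: cf.
have csq (f : R -> R) : {for t, continuous f} ->
    {for t, continuous (fun s => f s ^+ 2)}.
  by move=> cf; rewrite /=; apply: cvgM; exact: cf.
apply: cvgD; apply: csq; apply: cvgM; try exact: cvg_cst.
  by apply: cvgM; [exact: cvg_cst | exact/cm/continuous_cos].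
apply: (@continuous_comp _ _ _ (fun s : R => eps * sin (pi * s)) cos).
  by apply: cvgM; [exact: cvg_cst | exact/cm/continuous_sin].
exact: continuous_cos.
Qed.

(** The speed X satisfies 2 X L <= X^2 + L^2, which removes the square root;
    then cos^2 = 1 - sin^2 is bounded by the hypothesis on sin.  The mean over a
    period of the right-hand side is its first term. *)
Lemma detour_speed_bound (L k d eps t : R) : 0 < L -> 0 < eps -> eps < d ->
  (forall y : R, `|y| < d -> k ^+ 2 * y ^+ 2 <= sin y ^+ 2) ->
  Num.sqrt (detour_speed_sqr L eps t) <=
    L * (1 + eps ^+ 2 / 4 * ((pi / L) ^+ 2 - k ^+ 2)) +
    L * (eps ^+ 2 / 4 * ((pi / L) ^+ 2 + k ^+ 2)) * cos (2 * pi * t).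
Proof.
move=> L0 eps0 epsd sinB.
have s0 : 0 <= detour_speed_sqr L eps t by rewrite addr_ge0// sqr_ge0.
set X := Num.sqrt _.
have XE : X ^+ 2 = detour_speed_sqr L eps t by rewrite sqr_sqrtr.
have CE : cos (2 * pi * t) = 2 * cos (pi * t) ^+ 2 - 1.
  by rewrite -mulrA mulr_natl cos_mulr2n mulr_natl.
have SE := cos2Dsin2 (pi * t); have PE := cos2Dsin2 (eps * sin (pi * t)).
have /sinB : `|eps * sin (pi * t)| < d.
  rewrite normrM gtr0_norm// (le_lt_trans _ epsd)// -[leRHS]mulr1.
  by rewrite ler_pM2l// sin_max.
move: XE; rewrite CE /detour_speed_sqr !exprMn.
move: (cos (pi * t) ^+ 2) (sin (pi * t) ^+ 2) SE PE => C S.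
move: (cos _ ^+ 2) (sin _ ^+ 2) => P Q CS PQ XE QB.
have amgm : 2 * (X * L) <= X ^+ 2 + L ^+ 2.
  by have := sqr_ge0 (X - L); rewrite sqrrB -mulr_natl; lra.
rewrite -(ler_pM2r L0) -(ler_pM2l (ltr0Sn R 1)).
apply: (le_trans amgm); rewrite XE.
rewrite exprVn.
have -> : P = 1 - Q by lra.
have SC : S = 1 - C by lra.
rewrite SC in QB.
have : L ^+ 2 * (k ^+ 2 * (eps ^+ 2 * (1 - C))) <= L ^+ 2 * Q.
  by rewrite ler_pM2l// exprn_gt0.
have -> : 2 * ((L * (1 + eps ^+ 2 / 4 * (pi ^+ 2 / L ^+ 2 - k ^+ 2)) +
    L * (eps ^+ 2 / 4 * (pi ^+ 2 / L ^+ 2 + k ^+ 2)) * (2 * C - 1)) * L) =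
  2 * L ^+ 2 + eps ^+ 2 * pi ^+ 2 * C - L ^+ 2 * (k ^+ 2 * (eps ^+ 2 * (1 - C))).
  by field; rewrite gt_eqF.
by lra.
Qed.

(** Any k with pi / L < k < 1 makes the first term of the bound of
    [detour_speed_bound] less than L. *)
Lemma detour_shorter (L : R) : pi < L -> exists2 d : R, 0 < d &
  forall eps : R, 0 < eps -> eps < d ->
  \int[lebesgue_measure]_(t in `[0, 1]) Num.sqrt (detour_speed_sqr L eps t) < L.
Proof.
move=> piL; have L0 : 0 < L := lt_trans (pi_gt0 R) piL.
have r0 : 0 < pi / L by rewrite divr_gt0// pi_gt0.
have r1 : pi / L < 1 by rewrite ltr_pdivrMr// mul1r.
pose k := (pi / L + 1) / 2.
have k01 : 0 < k < 1 by apply/andP; split; rewrite /k; lra.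
have rk : pi / L < k by rewrite /k; lra.
have [d d0 dP] := sin_sqr_lower_bound k01.
exists d => // eps eps0 epsd.
pose a := L * (1 + eps ^+ 2 / 4 * ((pi / L) ^+ 2 - k ^+ 2)).
pose b := L * (eps ^+ 2 / 4 * ((pi / L) ^+ 2 + k ^+ 2)).
apply: (@le_lt_trans _ _ a).
  rewrite -(integral_cos_wave a b); apply: le_Rintegral => //.
  - exact/segment_integrable/continuous_detour_speed.
  - apply: segment_integrable => t; apply: cvgD; first exact: cvg_cst.
    apply: cvgM; first exact: cvg_cst.
    apply: (@continuous_comp _ _ _ (fun s : R => 2 * pi * s) cos t).
      exact: continuous_mull.
    exact: continuous_cos.
  - by move=> t _; exact: detour_speed_bound eps0 epsd dP.
rewrite /a -[ltRHS]mulr1 ltr_pM2l// gtrDl pmulr_rlt0; last first.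
  by rewrite divr_gt0// exprn_gt0.
by rewrite subr_lt0 ltrXn2r// ?nnegrE ltW.
Qed.

End DetourLength.

(** * The angle *)

Section Shortening.
Variables (R : realType) (n : nat).

Lemma continuous_detour (e1 e2 e3 : 'rV[R]_n) (L : R) :
  continuous (fun p : R * R => detour e1 e2 e3 L p.1 p.2).
Proof.
have cscale (f : R * R -> R) (g : R * R -> 'rV[R]_n) :
    continuous f -> continuous g -> continuous (fun p => f p *: g p).
  by move=> cf cg p; apply: cvgZ; [exact: cf | exact: cg].
have cadd (f g : R * R -> 'rV[R]_n) :
    continuous f -> continuous g -> continuous (fun p => f p + g p).
  by move=> cf cg p; apply: cvgD; [exact: cf | exact: cg].
have cmul (f g : R * R -> R) :
    continuous f -> continuous g -> continuous (fun p => f p * g p).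
  by move=> cf cg p; apply: cvgM; [exact: cf | exact: cg].
have ccst (W : topologicalType) (w : W) : continuous (fun _ : R * R => w).
  by move=> p; exact: cvg_cst.
have ccomp (f : R -> R) (g : R * R -> R) : continuous f -> continuous g ->
    continuous (fun p => f (g p)).
  by move=> cf cg p; apply: continuous_comp; [exact: cg | exact: cf].
have c1 : continuous (fun p : R * R => p.1) by move=> p; exact: cvg_fst.
have c2 : continuous (fun p : R * R => p.2) by move=> p; exact: cvg_snd.
have cphi : continuous (fun p : R * R => p.1 * sin (pi * p.2)).
  exact: cmul c1 (ccomp _ _ (@continuous_sin R) (cmul _ _ (ccst _ pi) c2)).
have cL : continuous (fun p : R * R => L * p.2) by exact: cmul (ccst _ L) c2.
have c3 := cadd _ _ (cscale _ _ (ccomp _ _ (@continuous_cos R) cL) (ccst _ e1))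
                    (cscale _ _ (ccomp _ _ (@continuous_sin R) cL) (ccst _ e2)).
exact (cadd _ _ (cscale _ _ (ccomp _ _ (@continuous_cos R) cphi) c3)
  (cscale _ _ (ccomp _ _ (@continuous_sin R) cphi) (ccst _ e3))).
Qed.

(** Compactness of the segment: the detour depends continuously on (eps, t). *)
Lemma detour_near (e1 e2 e3 : 'rV[R]_n) (L : R) (W : set 'rV[R]_n) : open W ->
  (forall t : R, 0 <= t <= 1 -> W (detour e1 e2 e3 L 0 t)) ->
  \forall eps \near (0 : R),
    `[0, 1]%classic `<=` [set t | W (detour e1 e2 e3 L eps t)].
Proof.
move=> oW W0.
have := (compact_near_coveringP _).1 (@segment_compact R 0 1) R (nbhs (0 : R))
  (fun eps t => W (detour e1 e2 e3 L eps t)) _.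
apply => t; rewrite /= in_itv /= => ht.
have cd := @continuous_detour e1 e2 e3 L (0, t).
have [[X Y] /= [X0 Yt] XY] : nbhs (0 : R, t) (fun p => W (detour e1 e2 e3 L p.1 p.2)).
  by apply: cd; apply: open_nbhs_nbhs; split=> //; exact: W0.
exists (Y, X) => //= -[s eps] [Ys Xeps]; exact: (XY (eps, s)).
Qed.

Variables (A : 'M[R]_n) (K : 'rV[R]_n -> R)
  (D D' : set 'rV[R]_n) (z z' : 'rV[R]_n -> 'rV[R]_n) (h : R).
Hypothesis F : homothetic_fibre A K D D' z z' h.

(** The competitor is the inverse image of the detour.  The points whose
    inverse image lies in O form an open set W containing the arc, hence
    containing the detour for small eps. *)
Lemma shorter_curve (U O : set 'rV[R]_n) (c : R -> 'rV[R]_n)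
    (e1 e2 : 'rV[R]_n) (L : R) :
  (2 < n)%N -> U `<=` D -> open O -> U = O `&` indicatrix K ->
  (forall t : R, 0 <= t <= 1 -> U (c t)) ->
  bform A e1 e1 = 1 -> bform A e2 e2 = 1 -> bform A e1 e2 = 0 ->
  (forall t : R, 0 <= t <= 1 ->
    z (c t) = cos (L * t) *: e1 + sin (L * t) *: e2) -> pi < L ->
  exists d, curve_in 1 U d (c 0) (c 1) /\
    curve_length (fmetric K) d < h^-1 * L.
Proof.
move=> n2 UD oO UE Uc e11 e22 e12 zc piL.
have pA := hf_posdef F.
have [e3 [e33 e31 e32]] := orthonormal_third e1 e2 pA n2.
pose W := [set v | D' v /\ O (z' v)].
have oW : open W.
  rewrite openE => v [D'v Ov]; apply: filterI.
    by apply: open_nbhs_nbhs; split=> //; exact: hf_cod_open F.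
  have := differentiable_continuous (fibre_inv_differentiable F D'v).
  by apply; exact: open_nbhs_nbhs.
have zW (t : R) : 0 <= t <= 1 -> W (detour e1 e2 e3 L 0 t).
  move=> ht; rewrite detour0 -zc//.
  have [D'zc zzc] := hf_map F (UD _ (Uc t ht)).
  by split=> //; rewrite zzc; move: (Uc t ht); rewrite UE => -[].
have [d0 d0_gt0 short] := detour_shorter piL.
have /nbhs_ballP[r /= r0 rP] := detour_near oW zW.
pose eps := Num.min r d0 / 2.
have m0 : 0 < Num.min r d0 by rewrite lt_min r0.
have eps0 : 0 < eps by rewrite divr_gt0.
have epsm : eps < Num.min r d0 by rewrite ltr_pdivrMr// mulr_natr mulr2n ltrDl.
have epsr : eps < r by move: epsm; rewrite lt_min => /andP[].
have epsd : eps < d0 by move: epsm; rewrite lt_min => /andP[].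
have sW (t : R) : 0 <= t <= 1 -> W (detour e1 e2 e3 L eps t).
  move=> ht; apply: (rP eps); last by rewrite /= in_itv.
  by rewrite -ball_normE /ball_ /= sub0r normrN gtr0_norm.
pose s := detour e1 e2 e3 L eps.
have cs : continuous s.
  move=> t; have c1 : {for t, continuous (fun t : R => (eps, t))}.
    have did : differentiable (id : R -> R) t by [].
    exact: differentiable_continuous
      (differentiable_pair (differentiable_cst eps t) did).
  exact: (continuous_comp c1 (@continuous_detour e1 e2 e3 L (eps, t))).
have oT : open (s @^-1` W) by apply: open_comp => // t _; exact: cs.
have Cs : Ck 1 s (s @^-1` W) by exact: detour_Ck.
pose d t := z' (s t).
have Dd (t : R) : 0 <= t <= 1 -> D (d t) /\ z (d t) = s t.
  by move=> /sW [D's _]; exact: hf_inv F _ D's.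
have Kd (t : R) : 0 <= t <= 1 -> K (d t) = 1.
  move=> ht; have [Ddt zd] := Dd t ht; apply/(hf_unit F Ddt).
  by rewrite /riem_norm zd /s detour_unit// sqrtr1.
have h01 : 0 <= (0 : R) <= 1 by rewrite lexx ler01.
have h11 : 0 <= (1 : R) <= 1 by rewrite lexx ler01.
exists d; split.
  split.
  - exists (s @^-1` W); split; first exact: oT.
      by move=> t /=; rewrite in_itv /= => ht; exact: sW.
    have sD (t : R) : (s @^-1` W) t -> D' (s t) by move=> [].
    exact: Ck_comp oT sD (@Ck_le _ _ _ 1 5 _ _ isT (hf_inv_C5 F)) Cs.
  - move=> t ht; rewrite UE; split; first by have [] := sW t ht.
    by split; [exact: (hf_neq0 F (Dd t ht).1) | exact: Kd].
  - rewrite /d /s detour_start detour0 -zc//.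
    by have [] := hf_map F (UD _ (Uc 0 h01)).
  - rewrite /d /s detour_end detour0 -zc//.
    by have [] := hf_map F (UD _ (Uc 1 h11)).
have ds (t : R) : differentiable s t.
  by have [+ _] := @detour_Ck R n e1 e2 e3 L eps setT openT; exact.
have zd' (t : R) : 0 <= t <= 1 -> 'D_(derive1 d t) z (d t) = 'D_1 s t.
  move=> ht; have [Ddt zd] := Dd t ht; have [D's _] := sW t ht.
  have dd : differentiable d t.
    exact: differentiable_comp (ds t) (fibre_inv_differentiable F D's).
  rewrite derive1E.
  apply: etrans (esym (derive_comp (1 : R) dd (fibre_differentiable F Ddt))) _.
  apply: near_eq_derive; apply: (eq_on_near oT (sW t ht)) => r' [D's' _].
  by have [_ ->] := hf_inv F D's'.
have hi0 : 0 <= h^-1 by rewrite invr_ge0 ltW// (hf_gt0 F).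
rewrite /curve_length; under eq_Rintegral => t.
  rewrite inE /= in_itv /= => ht.
  rewrite (bform_fmetric_indicatrix F _ _ (Dd t ht).1 (Kd t ht)) zd'//.
  rewrite detour_speedE// -exprVn sqrtrM ?sqr_ge0// sqrtr_sqr (ger0_norm hi0).
  over.
rewrite RintegralZl//; last exact/segment_integrable/continuous_detour_speed.
by rewrite ltr_pM2l ?invr_gt0 ?(hf_gt0 F)//; exact: short.
Qed.

(** A geodesic arc of U cannot be shortened in U, so L <= pi by
    [shorter_curve], and arccos undoes the cosine L |-> <z u, z v>. *)
Lemma geodesic_arc_length (U O : set 'rV[R]_n) (c : R -> 'rV[R]_n)
    (u v : 'rV[R]_n) :
  (2 < n)%N -> U `<=` D -> open O -> U = O `&` indicatrix K ->
  geodesic_arc K U c u v ->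
  curve_length (fmetric K) c = h^-1 * acos (bform A (z u) (z v)).
Proof.
move=> n2 UD oO UE [[[T [oT T01 Cc]] Uc c0 c1] gc cmin].
have UK : U `<=` indicatrix K by rewrite UE => y [].
have [L [e [L0 ee qe zc len]]] := geodesic_great_circle F UD UK oT T01 Cc Uc gc.
have h01 : 0 <= (0 : R) <= 1 by rewrite lexx ler01.
have h11 : 0 <= (1 : R) <= 1 by rewrite lexx ler01.
have e11 : bform A (z (c 0)) (z (c 0)) = 1.
  by apply: (fibre_unit F); [exact/UD/Uc | have [] := UK _ (Uc 0 h01)].
have Lpi : L <= pi.
  rewrite leNgt; apply/negP => piL.
  have L_neq0 : L != 0 by rewrite gt_eqF// (lt_trans (pi_gt0 R)).
  have [d [dU dlt]] := shorter_curve n2 UD oO UE Uc e11 (ee L_neq0) qe zc piL.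
  by have := cmin d; rewrite -c0 -c1 => /(_ dU); rewrite len leNgt dlt.
rewrite len -c0 -c1 (zc 1 h11) mulr1 bformDr !bformZr e11 qe mulr0 addr0 mulr1.
by rewrite cosK// in_itv /= L0.
Qed.

(** All geodesic arcs joining the two points have the length given by
    [geodesic_arc_length], so the chosen one has; the Riemannian angle does not
    change when y1 and y2 are scaled to the indicatrix. *)
Lemma finsleroid_angleE (U : set 'rV[R]_n) (y1 y2 : 'rV[R]_n) :
  (2 < n)%N -> indicatrix_region K D U ->
  y1 != 0 -> y2 != 0 -> U ((K y1)^-1 *: y1) -> U ((K y2)^-1 *: y2) ->
  finsleroid_angle K U y1 y2 = h^-1 * riem_angle A (z y1) (z y2).
Proof.
move=> n2 [UD [B oB UE] _ Ugeo] y10 y20 U1 U2.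
have angleE : riem_angle A (z y1) (z y2) =
    acos (bform A (z ((K y1)^-1 *: y1)) (z ((K y2)^-1 *: y2))).
  have norm y : y != 0 -> U ((K y)^-1 *: y) ->
      z y = riem_norm A (z y) *: z ((K y)^-1 *: y) /\ riem_norm A (z y) != 0.
    move=> y0 Uy; have K0 := hf_K_gt0 F y0.
    have Dy : D y.
      by have := hf_cone F K0 (UD _ Uy); rewrite scalerA divff ?scale1r// gt_eqF.
    have KE : K y `^ (h *+ 2) = (K y `^ h) ^+ 2.
      by rewrite -mulr_natr powRrM powR_mulrn// powR_ge0.
    have -> : riem_norm A (z y) = K y `^ h.
      by rewrite /riem_norm (fibre_norm_sqr F Dy) KE sqrtr_sqr ger0_norm// powR_ge0.
    split; last by rewrite gt_eqF// powR_gt0.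
    rewrite -(hf_hom F (UD _ Uy) K0) scalerA divff ?scale1r// gt_eqF//.
  have [E1 r1] := norm y1 y10 U1; have [E2 r2] := norm y2 y20 U2.
  rewrite /riem_angle {1}E1 {1}E2 bformZl bformZr; congr acos.
  by rewrite mulrA mulrAC mulfV ?mul1r// mulf_neq0.
rewrite angleE /finsleroid_angle; apply: xget_unique.
  have [c cgeo] := Ugeo _ _ U1 U2.
  by exists c => //; rewrite (geodesic_arc_length n2 UD oB UE cgeo).
by move=> s [c cgeo ->]; rewrite (geodesic_arc_length n2 UD oB UE cgeo).
Qed.

End Shortening.

Theorem theorem2p3 (R : realType) (N : nat) (hN : (2 < N)%N)
    (M : manifold R N) (K : finsler M) (a : riemannian M)
    (zeta : fibre_map M) (h C : M -> R)
    (hconf : conformally_isomorphic K a zeta h)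
    (hC : forall x, C x = h x ^+ 2)
    (x : M) (i : chart M) (hx : chdom i x) :
  constant_curvature (fmetric (K i x))
    (indicatrix (K i x) `&` tr_dom zeta i x) (C x) /\
  forall U : set 'rV[R]_N, indicatrix_region (K i x) (tr_dom zeta i x) U ->
  forall y1 y2 : 'rV[R]_N, y1 != 0 -> y2 != 0 ->
    U ((K i x y1)^-1 *: y1) -> U ((K i x y2)^-1 *: y2) ->
    finsleroid_angle (K i x) U y1 y2 =
    (Num.sqrt (C x))^-1 * riem_angle (a i x) (zeta i x y1) (zeta i x y2).
Proof.
have [h0 zhom zunit zmetric] := hconf i x hx.
have F : homothetic_fibre (a i x) (K i x) (tr_dom zeta i x) (tr_cod zeta i x)
    (zeta i x) (tr_inv zeta i x) (h x).
  split=> //.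
  - exact: rmetric_posdef hx.
  - by move=> y; exact: finsler_gt0 hx.
  - by move=> y c; exact: finsler_hom hx.
  - exact: tr_dom_open hx.
  - exact: tr_cod_open hx.
  - by move=> y; exact: tr_dom_neq0 hx.
  - by move=> y c c0; exact: tr_dom_cone hx c0.
  - by move=> y; exact: tr_mapP hx.
  - by move=> v; exact: tr_invP hx.
  - exact: tr_map_C5 hx.
  - exact: tr_inv_C5 hx.
split; first by rewrite hC; exact: indicatrix_constant_curvature F.
move=> U Ureg y1 y2 y10 y20 U1 U2.
rewrite hC sqrtr_sqr (ger0_norm (ltW h0)).
exact: (finsleroid_angleE F hN Ureg y10 y20 U1 U2).
Qed.
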